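(* Consider $$F^\star:=\min_{z=(x,y)}\{F(z):=f(x)+g(y)+h(y)\;:\;Ax+By-c\in\mathcal K\},$$ where $h:\mathbb R^{p_2}\to\mathbb R$ is convex and differentiable with $L_h$-Lipschitz continuous gradient, $L_h>0$. Let $z^\star=(x^\star,y^\star)\in\mathcal Z^\star$ and $\lambda^\star\in\Lambda^\star$, and put $$R_p^2:=\gamma_0\|x^0-x^\star\|^2+(L_h+\rho_0\|B\|^2)\|y^0-y^\star\|^2,\qquad R_d:=\|\lambda^\star\|+\sqrt{\|\lambda^\star\|^2+\rho_0R_p^2}.$$ (1) Let $\{z^k=(x^k,y^k)\}$ be generated by the modified Algorithm 1 described in the context, with $\hat\beta_k:=\rho_k\|B\|^2+L_h$. Then for all $k\ge1$, $$|F(z^k)-F^\star|\le\frac{\max\{\rho_0R_p^2,2\|\lambda^\star\|R_d\}}{2\rho_0k},\qquad \mathrm{dist}_{\mathcal K}(Ax^k+By^k-c)\le\frac{R_d}{\rho_0k}.$$ (2) Assume that either $g$ is $\mu_g$-strongly convex or $h$ is $\mu_h$-strongly convex such that $\mu_g+\mu_h>0$ (with $\mu_g,\mu_h\ge0$). Let $\{z^k=(x^k,y^k)\}$ be generated by the modified Algorithm 2 described in the context with the following choices: (i) if $\mu_g>0$: $\bar y^k:=\hat y^k$, $0<\rho_0\le\frac{\mu_g}{2\|B\|^2}$, and $\hat\beta_k:=\rho_k\|B\|^2+L_h$; (ii) if $L_h<2\mu_h$: $\bar y^k:=\tilde y^k$, $0<\rho_0\le\frac{\mu_g+2\mu_h-L_h}{2\|B\|^2}$,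 and $\hat\beta_k:=\rho_k\|B\|^2+\frac{L_h}{\tau_k}$. Then, in each case, for all $k\ge1$, $$|F(z^k)-F^\star|\le\frac{2\max\{\rho_0R_p^2,2\|\lambda^\star\|R_d\}}{\rho_0(k+1)^2},\qquad \mathrm{dist}_{\mathcal K}(Ax^k+By^k-c)\le\frac{4R_d}{\rho_0(k+1)^2}.$$
   Context: Setting. $f:\mathbb R^{p_1}\to\mathbb R\cup\{+\infty\}$ and $g:\mathbb R^{p_2}\to\mathbb R\cup\{+\infty\}$ are proper, closed, convex; $A\in\mathbb R^{n\times p_1}$, $B\in\mathbb R^{n\times p_2}$ with $B\ne0$, $c\in\mathbb R^n$; $\mathcal K\subseteq\mathbb R^n$ is nonempty, closed, convex. $\|\cdot\|$ is the Euclidean norm for vectors and the induced operator norm for matrices. A function $q$ is $\mu$-strongly convex ($\mu\ge0$, with $\mu=0$ meaning convex) if $q-\frac\mu2\|\cdot\|^2$ is convex. $\mathrm{dom}(F)=\mathrm{dom}(f)\times\mathrm{dom}(g)$. Lagrange function: $\mathcal L(x,y,r,\lambda):=f(x)+g(y)+h(y)-\langle Ax+By-r-c,\lambda\rangle$ with $r\in\mathcal K$. A point $(x^\star,y^\star,r^\star,\lambda^\star)\in\mathrm{dom}(f)\times\mathrm{dom}(g)\times\mathcal K\times\mathbb R^n$ is a saddle point if $\mathcal L(x^\star,y^\star,r^\star,\lambda)\le\mathcal L(x^\star,y^\star,r^\star,\lambda^\star)\le\mathcal L(x,y,r,\lambda^\star)$ for all $(x,y)\in\mathrm{dom}(F)$,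 $r\in\mathcal K$, $\lambda\in\mathbb R^n$. $\mathcal Z^\star$ is the set of $(x^\star,y^\star)$-components and $\Lambda^\star$ the set of $\lambda^\star$-components of saddle points. Standing assumption: the set of saddle points is nonempty, and $F^\star$ is finite and attained at some $(x^\star,y^\star)\in\mathcal Z^\star$. $\mathrm{dist}_{\mathcal K}$ and $\mathrm{proj}_{\mathcal K}$ are the Euclidean distance to and projection onto $\mathcal K$. $\psi(x,y):=\frac12\mathrm{dist}_{\mathcal K}(Ax+By-c)^2$, and $\nabla_y\psi(x,y)=B^\top\big(Ax+By-c-\mathrm{proj}_{\mathcal K}(Ax+By-c)\big)$. For $\gamma>0$, $\mathrm{prox}_{\gamma g}(v):=\arg\min_u\{g(u)+\frac1{2\gamma}\|u-v\|^2\}$. Modified Algorithm 1. Choose $(x^0,y^0)\in\mathrm{dom}(F)$, $\rho_0>0$, $\gamma_0\ge0$; set $\hat x^0:=x^0$, $\hat y^0:=y^0$. For $k=0,1,2,\dots$: - $x^{k+1}\in\arg\min_x\{f(x)+\rho_k\psi(x,\hat y^k)+\frac{\gamma_k}2\|x-\hat x^k\|^2\}$ (assumed nonempty; any element may be taken); - $y^{k+1}:=\mathrm{prox}_{g/\hat\beta_k}\big(\hat y^k-\frac1{\hat\beta_k}(\nabla h(\hat y^k)+\rho_k\nabla_y\psi(x^{k+1},\hat y^k))\big)$; - $(\hat x^{k+1},\hat y^{k+1}):=(x^{k+1},y^{k+1})+\frac{k}{k+2}(x^{k+1}-x^k,\,y^{k+1}-y^k)$; - $\rho_{k+1}:=(k+2)\rho_0$,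 $\gamma_{k+1}:=\gamma_0(k+2)$. Modified Algorithm 2. Choose $(x^0,y^0)\in\mathrm{dom}(F)$, $\rho_0$ as specified in the claim, $\gamma_0\ge0$; set $\tau_0:=1$, $\hat x^0:=x^0$, $\tilde y^0:=y^0$. For $k=0,1,2,\dots$: - $\tau_{k+1}:=\frac{\tau_k}2\big((\tau_k^2+4)^{1/2}-\tau_k\big)$; - $\hat y^k:=(1-\tau_k)y^k+\tau_k\tilde y^k$; - $x^{k+1}\in\arg\min_x\{f(x)+\rho_k\psi(x,\hat y^k)+\frac{\gamma_0}2\|x-\hat x^k\|^2\}$ (assumed nonempty; any element may be taken); - $\hat x^{k+1}:=x^{k+1}+\frac{\tau_{k+1}(1-\tau_k)}{\tau_k}(x^{k+1}-x^k)$; - $\tilde y^{k+1}:=\mathrm{prox}_{g/(\tau_k\hat\beta_k)}\big(\tilde y^k-\frac1{\tau_k\hat\beta_k}(\nabla h(\bar y^k)+\rho_k\nabla_y\psi(x^{k+1},\hat y^k))\big)$; - Option 1: $y^{k+1}:=(1-\tau_k)y^k+\tau_k\tilde y^{k+1}$; or Option 2: $y^{k+1}:=\mathrm{prox}_{g/\breve\beta_k}\big(\hat y^k-\frac1{\breve\beta_k}(\nabla h(\hat y^k)+\rho_k\nabla_y\psi(x^{k+1},\hat y^k))\big)$ with $\breve\beta_k:=\rho_k\|B\|^2+L_h$; - $\rho_{k+1}:=\frac{\rho_k}{1-\tau_{k+1}}$. *)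

(* Defs.v *)
From HB Require Import structures.
From mathcomp Require Import all_boot all_order all_algebra.
From mathcomp Require Import all_classical all_reals all_analysis.

Set Implicit Arguments.
Unset Strict Implicit.
Unset Printing Implicit Defensive.

Import Order.TTheory GRing.Theory Num.Theory.
Import numFieldNormedType.Exports.

Local Open Scope classical_set_scope.
Local Open Scope ring_scope.

(* The library norm on matrices is the sup norm; it induces the same topology,
   and hence the same closed sets and derivatives, as the Euclidean norm. *)
Definition dotv (R : realType) (m : nat) (u v : 'cV[R]_m) : R :=
  \sum_(i < m) u i 0 * v i 0.

Definition enorm (R : realType) (m : nat) (u : 'cV[R]_m) : R :=
  Num.sqrt (dotv u u).

Definition opnorm (R : realType) (m p : nat) (M : 'M[R]_(m, p)) : R :=
  sup [set enorm (M *m v) | v in [set v : 'cV[R]_p | enorm v <= 1]].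

Definition edom (R : realType) (T : Type) (q : T -> \bar R) : set T :=
  [set u | (q u < +oo)%E].

Definition proper_function (R : realType) (T : Type) (q : T -> \bar R) : Prop :=
  (forall u, q u != -oo%E) /\ edom q !=set0.

Definition closed_function (R : realType) (m : nat) (q : 'cV[R]_m -> \bar R) :
    Prop :=
  closed [set z : 'cV[R]_m * R | (q z.1 <= z.2%:E)%E].

(* Intended for functions that never take the value -oo. At t = 0 and t = 1 the
   convention 0 * +oo = 0 makes the inequality trivial. *)
Definition econvex (R : realType) (m : nat) (q : 'cV[R]_m -> \bar R) : Prop :=
  forall (u v : 'cV[R]_m) (t : R), 0 <= t <= 1 ->
    (q (t *: u + (1 - t) *: v)%R <= t%:E * q u + (1 - t)%:E * q v)%E.

Definition strongly_convex (R : realType) (m : nat) (mu : R)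
    (q : 'cV[R]_m -> \bar R) : Prop :=
  econvex (fun u => q u - (mu / 2 * enorm u ^+ 2)%:E)%E.

Definition grad (R : realType) (m : nat) (q : 'cV[R]_m -> R) (u : 'cV[R]_m) :
    'cV[R]_m :=
  \col_(i < m) 'D_(delta_mx i 0) q u.

Definition argmin (R : realType) (T : Type) (q : T -> \bar R) : set T :=
  [set u | forall v, (q u <= q v)%E].

(* [is_prox gam q v u] is u = prox_{gam q}(v); the minimizer is unique when q is
   proper, closed and convex and gam > 0. *)
Definition is_prox (R : realType) (m : nat) (gam : R) (q : 'cV[R]_m -> \bar R)
    (v u : 'cV[R]_m) : Prop :=
  argmin (fun w => q w + (1 / (2 * gam) * enorm (w - v) ^+ 2)%:E)%E u.

Definition dist_to (R : realType) (m : nat) (K : set 'cV[R]_m) (u : 'cV[R]_m) : R :=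
  inf [set enorm (u - r) | r in K].

Section problem.
Variables (R : realType) (n p1 p2 : nat).
Variables (f : 'cV[R]_p1 -> \bar R) (g : 'cV[R]_p2 -> \bar R).
Variables (h : 'cV[R]_p2 -> R).
Variables (A : 'M[R]_(n, p1)) (B : 'M[R]_(n, p2)) (c : 'cV[R]_n).
Variables (K : set 'cV[R]_n).

Definition obj (x : 'cV[R]_p1) (y : 'cV[R]_p2) : \bar R :=
  (f x + g y + (h y)%:E)%E.

Definition resid (x : 'cV[R]_p1) (y : 'cV[R]_p2) : 'cV[R]_n :=
  A *m x + B *m y - c.

Definition Fstar : \bar R :=
  ereal_inf [set obj z.1 z.2 | z in [set z | K (resid z.1 z.2)]].

Definition lagrangian (x : 'cV[R]_p1) (y : 'cV[R]_p2) (r l : 'cV[R]_n) :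
    \bar R :=
  (obj x y - (dotv (A *m x + B *m y - r - c) l)%:E)%E.

Definition saddle_point (xs : 'cV[R]_p1) (ys : 'cV[R]_p2) (rs ls : 'cV[R]_n) :
    Prop :=
  [/\ edom f xs, edom g ys, K rs,
      forall l, (lagrangian xs ys rs l <= lagrangian xs ys rs ls)%E &
      forall x y r, edom f x -> edom g y -> K r ->
        (lagrangian xs ys rs ls <= lagrangian x y r ls)%E].

Definition Zstar : set ('cV[R]_p1 * 'cV[R]_p2) :=
  [set z | exists rs ls, saddle_point z.1 z.2 rs ls].

Definition Lstar : set 'cV[R]_n :=
  [set ls | exists xs ys rs, saddle_point xs ys rs ls].

Definition psi (x : 'cV[R]_p1) (y : 'cV[R]_p2) : R :=
  2^-1 * dist_to K (resid x y) ^+ 2.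

(* Equal to B^T (resid x y - proj_K (resid x y)) for K nonempty closed convex. *)
Definition grad_y_psi (x : 'cV[R]_p1) (y : 'cV[R]_p2) : 'cV[R]_p2 :=
  grad (psi x) y.

(* xh, yh, yt, yb stand for the hatted, hatted, tilded and barred iterates;
   bh for the hatted beta. *)
Record algorithm1 (rho0 gamma0 : R) (rho gamma bh : nat -> R)
    (x xh : nat -> 'cV[R]_p1) (y yh : nat -> 'cV[R]_p2) : Prop := Algorithm1 {
  alg1_dom_x : edom f (x 0%N);
  alg1_dom_y : edom g (y 0%N);
  alg1_rho0_gt0 : 0 < rho0;
  alg1_gamma0_ge0 : 0 <= gamma0;
  alg1_rho0 : rho 0%N = rho0;
  alg1_gamma0 : gamma 0%N = gamma0;
  alg1_xh0 : xh 0%N = x 0%N;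
  alg1_yh0 : yh 0%N = y 0%N;
  alg1_x : forall k,
    argmin (fun u => f u + (rho k * psi u (yh k)
                            + gamma k / 2 * enorm (u - xh k) ^+ 2)%:E)%E
           (x k.+1);
  alg1_y : forall k,
    is_prox (1 / bh k) g
      (yh k - (1 / bh k) *: (grad h (yh k)
                             + rho k *: grad_y_psi (x k.+1) (yh k)))
      (y k.+1);
  alg1_xh : forall k,
    xh k.+1 = x k.+1 + (k%:R / k.+2%:R) *: (x k.+1 - x k);
  alg1_yh : forall k,
    yh k.+1 = y k.+1 + (k%:R / k.+2%:R) *: (y k.+1 - y k);
  alg1_rho : forall k, rho k.+1 = k.+2%:R * rho0;
  alg1_gamma : forall k, gamma k.+1 = gamma0 * k.+2%:R
}.

(* The two updates of y are alternatives at every iteration. *)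
Record algorithm2 (Lh rho0 gamma0 : R) (tau rho bh : nat -> R)
    (x xh : nat -> 'cV[R]_p1) (y yh yt yb : nat -> 'cV[R]_p2) : Prop :=
    Algorithm2 {
  alg2_dom_x : edom f (x 0%N);
  alg2_dom_y : edom g (y 0%N);
  alg2_rho0_gt0 : 0 < rho0;
  alg2_gamma0_ge0 : 0 <= gamma0;
  alg2_rho0 : rho 0%N = rho0;
  alg2_tau0 : tau 0%N = 1;
  alg2_xh0 : xh 0%N = x 0%N;
  alg2_yt0 : yt 0%N = y 0%N;
  alg2_tau : forall k,
    tau k.+1 = tau k / 2 * (Num.sqrt (tau k ^+ 2 + 4) - tau k);
  alg2_yh : forall k, yh k = (1 - tau k) *: y k + tau k *: yt k;
  alg2_x : forall k,
    argmin (fun u => f u + (rho k * psi u (yh k)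
                            + gamma0 / 2 * enorm (u - xh k) ^+ 2)%:E)%E
           (x k.+1);
  alg2_xh : forall k,
    xh k.+1 =
      x k.+1 + (tau k.+1 * (1 - tau k) / tau k) *: (x k.+1 - x k);
  alg2_yt : forall k,
    is_prox (1 / (tau k * bh k)) g
      (yt k - (1 / (tau k * bh k)) *:
                (grad h (yb k) + rho k *: grad_y_psi (x k.+1) (yh k)))
      (yt k.+1);
  alg2_y : forall k,
    y k.+1 = (1 - tau k) *: y k + tau k *: yt k.+1 \/
    (let bb := rho k * opnorm B ^+ 2 + Lh in
     is_prox (1 / bb) g
       (yh k - (1 / bb) *: (grad h (yh k)
                            + rho k *: grad_y_psi (x k.+1) (yh k)))
       (y k.+1));
  alg2_rho : forall k, rho k.+1 = rho k / (1 - tau k.+1)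
}.

End problem.

(* The square of R_p. *)
Definition Rp2 (R : realType) (n p1 p2 : nat) (B : 'M[R]_(n, p2))
    (Lh rho0 gamma0 : R) (x0 xs : 'cV[R]_p1) (y0 ys : 'cV[R]_p2) : R :=
  gamma0 * enorm (x0 - xs) ^+ 2
  + (Lh + rho0 * opnorm B ^+ 2) * enorm (y0 - ys) ^+ 2.

Definition Rd (R : realType) (n p1 p2 : nat) (B : 'M[R]_(n, p2))
    (Lh rho0 gamma0 : R) (x0 xs : 'cV[R]_p1) (y0 ys : 'cV[R]_p2)
    (ls : 'cV[R]_n) : R :=
  enorm ls + Num.sqrt (enorm ls ^+ 2 + rho0 * Rp2 B Lh rho0 gamma0 x0 xs y0 ys).

(* Main.v *)
Require Import Defs.
From HB Require Import structures.
From mathcomp Require Import all_boot all_order all_algebra.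
From mathcomp Require Import all_classical all_reals all_analysis.
From mathcomp Require Import ring lra.

Import Order.TTheory GRing.Theory Num.Theory.
Import numFieldNormedType.Exports.

Local Open Scope classical_set_scope.
Local Open Scope ring_scope.

(** Write d for the distance of the residual A x + B y - c to K, so that psi is
    d ^ 2 / 2, and z = (x, y).  Both schemes are accelerated proximal methods on
    the penalized function F + rho_k psi, with rho_k = w_k rho_0 growing along
    the iterations: w_k = k + 1 and tau_k = 1 / (k + 1) for the first scheme,
    w_k = 1 / tau_k ^ 2 for the second.  In both, w_{k+1} (1 - tau_{k+1}) = w_k,
    that is, (1 - tau_{k+1}) rho_{k+1} = rho_k.

    From the gap to the theorem.  A multiplier ls of a saddle point bounds the
    objective from below, F(z) - F* >= - |ls| d ([dual_lower_bound]).  An upper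
    bound F(z) + w rho_0 psi(z) - F* <= R_p ^ 2 / (2 w) then turns into a
    quadratic inequality in d, whose solution is d <= R_d / (rho_0 w), and both
    estimates follow ([gap_dist_bound]).

    One iteration.  With E_k = F(z^k) - F* + (1 - tau_k) rho_k psi(z^k), each
    step gives an inequality
      E_{k+1} + tau_k ^ 2 S'_k <= (1 - tau_k) E_k + tau_k ^ 2 S_k,
    where S_k and S'_k are weighted squared distances to the solution.  The
    x-update is exact and contributes [x_update_descent].  It also pays for the
    growth of the penalty: psi is half the squared norm of the offset
    s(w) = w - proj(w), a gradient which is 1-cocoercive, and the quadratic
    terms left by this cocoercivity at z^k and at the solution dominate
    tau_k (1 - tau_k) rho_k psi(z^k) ([weighted_square2]).  The y-update only
    sees a quadratic model at the extrapolated point; its contribution has the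
    common shape [y_descent].  Multiplying by w_k and telescoping gives
    w_k E_{k+1} <= S_0 <= R_p ^ 2 / 2 ([lyapunov_decrease],
    [penalty_gap_rate]).

    The second scheme divides by tau_k ^ 2, so the weight of |yt - ys| ^ 2 is
    no longer nonincreasing: it grows with rho_k.  Strong convexity of g or h
    adds mug / tau_k or muh / tau_k, and since tau_k / 2 <= tau_{k+1} the bound
    on rho_0 makes this enough.

    The delicate combination is a gradient of h taken at yt together with the
    proximal step at yh for y.  The two linearizations of h differ, and the
    discrepancy is not controlled by the squared distances above.  It is
    absorbed by adding Lh / 2 |y - yt| ^ 2 to the potential: cocoercivity of
    grad h bounds the discrepancy ([linearization_gap]), and the new term
    contracts because the prox step that defines y is itself strongly convex
    ([y_update_options]). *)

(** * Euclidean geometry of column vectors *)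

Section euclidean.
Context {R : realType}.

Lemma dotvC {m} (u v : 'cV[R]_m) : dotv u v = dotv v u.
Proof. by apply: eq_bigr => i _; rewrite mulrC. Qed.

Lemma dotvDl {m} (u v w : 'cV[R]_m) : dotv (u + v) w = dotv u w + dotv v w.
Proof. by rewrite -big_split; apply: eq_bigr => i _; rewrite mxE mulrDl. Qed.

Lemma dotvZl {m} (a : R) (u w : 'cV[R]_m) : dotv (a *: u) w = a * dotv u w.
Proof. by rewrite mulr_sumr; apply: eq_bigr => i _; rewrite mxE mulrA. Qed.

Lemma dotvNl {m} (u w : 'cV[R]_m) : dotv (- u) w = - dotv u w.
Proof. by rewrite -scaleN1r dotvZl mulN1r. Qed.

Lemma dotv0l {m} (w : 'cV[R]_m) : dotv 0 w = 0.
Proof. by rewrite -(scale0r 0) dotvZl mul0r. Qed.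

Lemma dotvDr {m} (u v w : 'cV[R]_m) : dotv w (u + v) = dotv w u + dotv w v.
Proof. by rewrite dotvC dotvDl !(dotvC w). Qed.

Lemma dotvZr {m} (a : R) (u w : 'cV[R]_m) : dotv w (a *: u) = a * dotv w u.
Proof. by rewrite dotvC dotvZl (dotvC w). Qed.

Lemma dotvNr {m} (u w : 'cV[R]_m) : dotv w (- u) = - dotv w u.
Proof. by rewrite dotvC dotvNl (dotvC w). Qed.

Definition dotvE := (@dotvDl, @dotvDr, @dotvNl, @dotvNr, @dotvZl, @dotvZr).

Lemma dotvv_ge0 {m} (u : 'cV[R]_m) : 0 <= dotv u u.
Proof. by apply: sumr_ge0 => i _; rewrite -expr2 sqr_ge0. Qed.

Lemma dotvv_eq0 {m} (u : 'cV[R]_m) : dotv u u = 0 -> u = 0.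
Proof.
move=> /eqP; rewrite psumr_eq0 => [/allP uu0|i _]; last first.
  by rewrite -expr2 sqr_ge0.
apply/colP => i; rewrite mxE; apply/eqP.
by have := uu0 i; rewrite mem_index_enum -expr2 sqrf_eq0 => /(_ isT).
Qed.

Lemma dot_mulmx {m p} (M : 'M[R]_(m, p)) (u : 'cV[R]_p) (v : 'cV[R]_m) :
  dotv (M *m u) v = dotv u (M^T *m v).
Proof.
have dotvM q (a b : 'cV[R]_q) : dotv a b = (a^T *m b) 0 0.
  by rewrite mxE; apply: eq_bigr => i _; rewrite mxE.
by rewrite !dotvM trmx_mul mulmxA.
Qed.

Lemma enorm_sq {m} (u : 'cV[R]_m) : enorm u ^+ 2 = dotv u u.
Proof. by rewrite sqr_sqrtr // dotvv_ge0. Qed.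

Lemma enorm_ge0 {m} (u : 'cV[R]_m) : 0 <= enorm u.
Proof. exact: sqrtr_ge0. Qed.

Lemma enorm0 m : enorm (0 : 'cV[R]_m) = 0.
Proof. by rewrite /enorm dotv0l sqrtr0. Qed.

Lemma enormZ {m} (a : R) (u : 'cV[R]_m) : enorm (a *: u) = `|a| * enorm u.
Proof.
by rewrite /enorm dotvZl dotvZr mulrA -expr2 sqrtrM ?sqr_ge0 // sqrtr_sqr.
Qed.

Lemma enormN {m} (u : 'cV[R]_m) : enorm (- u) = enorm u.
Proof. by rewrite /enorm dotvNl dotvNr opprK. Qed.

Lemma dotv_le_enorm {m} (u v : 'cV[R]_m) : dotv u v <= enorm u * enorm v.
Proof.
have [u0|u0] := eqVneq (enorm u) 0.
  have -> : u = 0 by apply: dotvv_eq0; rewrite -enorm_sq u0 expr0n.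
  by rewrite enorm0 mul0r dotv0l.
have [v0|v0] := eqVneq (enorm v) 0.
  have -> : v = 0 by apply: dotvv_eq0; rewrite -enorm_sq v0 expr0n.
  by rewrite enorm0 mulr0 dotvC dotv0l.
have u_gt0 : 0 < enorm u by rewrite lt_def u0 enorm_ge0.
have v_gt0 : 0 < enorm v by rewrite lt_def v0 enorm_ge0.
have := dotvv_ge0 (enorm v *: u - enorm u *: v).
rewrite !dotvE -!enorm_sq (dotvC v u) => sq_ge0.
rewrite -(ler_pM2l (mulr_gt0 u_gt0 v_gt0)); nra.
Qed.

Lemma enorm_le {m} (u v : 'cV[R]_m) :
  (enorm u <= enorm v) = (dotv u u <= dotv v v).
Proof. by rewrite ler_psqrt // nnegrE dotvv_ge0. Qed.

(** Each coordinate of M v is an inner product with a row of M, so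
    Cauchy-Schwarz bounds the norm by the Frobenius norm of M; without this
    bound the supremum defining [opnorm] would carry no information. *)
Lemma opnorm_bounded {m p} (M : 'M[R]_(m, p)) :
  has_sup [set enorm (M *m v) | v in [set v : 'cV[R]_p | enorm v <= 1]].
Proof.
split; first by exists (enorm (M *m 0)), 0 => //=; rewrite enorm0 ler01.
pose row_t (i : 'I_m) : 'cV[R]_p := (row i M)^T.
exists (Num.sqrt (\sum_(i < m) enorm (row_t i) ^+ 2)) => _ [v /= v1 <-].
apply: ler_wsqrtr; apply: ler_sum => i _.
have -> : (M *m v) i 0 = dotv (row_t i) v.
  by rewrite mxE; apply: eq_bigr => j _; rewrite !mxE.
have := dotv_le_enorm (row_t i) v.
have := dotv_le_enorm (row_t i) (- v); rewrite dotvNr enormN.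
have := enorm_ge0 (row_t i); have := enorm_ge0 v.
move: (dotv _ _) (enorm v) v1 (enorm (row_t i)) => d a a1 b a0 b0 lo up.
have ab : b * a <= b by rewrite ler_piMr.
have : 0 <= (b - d) * (b + d) by apply: mulr_ge0; lra.
by nra.
Qed.

Lemma opnorm_ge0 {m p} (M : 'M[R]_(m, p)) : 0 <= opnorm M.
Proof.
apply: le_trans (ub_le_sup (opnorm_bounded M).2 _); last first.
  by exists 0 => //=; rewrite enorm0 ler01.
exact: enorm_ge0.
Qed.

Lemma dotv_mulmx_le {m p} (M : 'M[R]_(m, p)) (v : 'cV[R]_p) :
  dotv (M *m v) (M *m v) <= opnorm M ^+ 2 * dotv v v.
Proof.
rewrite -!enorm_sq -exprMn.
suff le : enorm (M *m v) <= opnorm M * enorm v.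
  by rewrite ler_sqr // nnegrE ?mulr_ge0 ?enorm_ge0 ?opnorm_ge0.
have [v0|v0] := eqVneq (enorm v) 0.
  have -> : v = 0 by apply: dotvv_eq0; rewrite -enorm_sq v0 expr0n.
  by rewrite mulmx0 !enorm0 mulr0.
have v_gt0 : 0 < enorm v by rewrite lt_def v0 enorm_ge0.
rewrite -ler_pdivrMr // mulrC.
apply: ub_le_sup; first exact: (opnorm_bounded M).2.
exists ((enorm v)^-1 *: v) => /=.
  by rewrite enormZ ger0_norm ?invr_ge0 ?enorm_ge0 // mulVf.
by rewrite -scalemxAr enormZ ger0_norm ?invr_ge0 ?enorm_ge0.
Qed.

End euclidean.

(** * Smooth and strongly convex functions *)

Section calculus.
Context {R : realType}.

(** The first-order conditions below are all obtained by dividing an inequality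
    along a segment by t and letting t tend to 0; this is that limit. *)
Lemma ge0_of_quadratic (a C : R) :
  (forall t, 0 < t <= 1 -> 0 <= t * a + C * t ^+ 2) -> 0 <= a.
Proof.
move=> quad_ge0; rewrite leNgt; apply/negP => a_lt0.
have C_gt0 : 0 < C by have := quad_ge0 1; rewrite ltr01 lexx => /(_ isT); nra.
(* At this t both t <= 1 and C t < - a hold. *)
pose t := - a / (2 * C - a).
have den_gt0 : 0 < 2 * C - a by lra.
have tE : t * (2 * C - a) = - a by rewrite divfK // gt_eqF.
have t_gt0 : 0 < t by rewrite divr_gt0 // oppr_gt0.
have t_le1 : t <= 1 by rewrite ler_pdivrMr //; lra.
have := quad_ge0 t; rewrite t_gt0 t_le1 => /(_ isT).
have Ct_lt : C * t < - a by rewrite -(ltr_pM2r den_gt0) -mulrA tE; nra.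
by rewrite expr2; nra.
Qed.

(** A two-sided quadratic error gives the derivative in one direction, which is
    all that [grad] needs. *)
Lemma derive_of_quadratic {m} (q : 'cV[R]_m -> R) (u v : 'cV[R]_m) (c C : R) :
  (forall t, `|q (u + t *: v) - q u - t * c| <= C * t ^+ 2) ->
  'D_v q u = c.
Proof.
move=> quad; apply: cvg_lim => //.
have C_ge0 : 0 <= C.
  by have := quad 1; rewrite expr1n mulr1; apply: le_trans.
apply/cvgrPdist_le => e e_gt0.
near=> t.
have t_neq0 : t != 0 by near: t; exact: nbhs_dnbhs_neq.
have abs_gt0 : 0 < `|t| by rewrite normr_gt0.
have small : C * `|t| <= e.
  have : `|t| < e / (C + 1) by near: t; apply: dnbhs0_lt; apply: divr_gt0; lra.
  rewrite ltr_pdivlMr; nra.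
rewrite distrC -(ler_pM2l abs_gt0) -normrM mulrBr.
rewrite [t * (_ *: _)]mulrA mulfV // mul1r /= [t *: v + u]addrC.
apply: le_trans (quad t) _.
by rewrite -[t ^+ 2]real_normK ?num_real // expr2 mulrCA; apply: ler_wpM2l.
Unshelve. all: by end_near.
Qed.

Lemma derive_grad {m} (q : 'cV[R]_m -> R) (u v : 'cV[R]_m) :
  differentiable q u -> 'D_v q u = dotv (grad q u) v.
Proof.
move=> dq; rewrite deriveE // {1}(matrix_sum_delta v) linear_sum /=.
apply: eq_bigr => i _; rewrite big_ord1 linearZ /= /grad !mxE deriveE //.
by rewrite mulrC.
Qed.

Lemma is_derive_line {m} (q : 'cV[R]_m -> R) (u d : 'cV[R]_m) (t : R) :
  differentiable q (u + t *: d) ->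
  is_derive t (1 : R) (fun t => q (u + t *: d))
    (dotv (grad q (u + t *: d)) d).
Proof.
move=> dq; rewrite -derive_grad //.
have quotE : (fun s : R =>
    s^-1 *: (((fun t => q (u + t *: d)) \o shift t) (s *: 1)
             - q (u + t *: d))) =
    (fun s => s^-1 *: ((q \o shift (u + t *: d)) (s *: d) - q (u + t *: d))).
  apply/funext => s /=; congr (_ *: (q _ - _)).
  by rewrite scalerDl [s *: 1]mulr1 addrCA.
by split; rewrite /derivable /derive quotE //; apply: diff_derivable.
Qed.

(** The mean value theorem applied to the signed error along the segment,
    minus its quadratic bound: the Lipschitz condition makes this function
    nonincreasing.  The sign [sg] gives the upper and the lower bound. *)
Lemma gradient_quadratic_bound {m} (q : 'cV[R]_m -> R) (L sg : R)
    (u d : 'cV[R]_m) :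
  (forall y, differentiable q y) ->
  (forall y y', enorm (grad q y - grad q y') <= L * enorm (y - y')) ->
  sg ^+ 2 = 1 ->
  sg * (q (u + d) - q u - dotv (grad q u) d) <= L / 2 * dotv d d.
Proof.
move=> dq lip sg1.
pose k t := sg * (q (u + t *: d) - t * dotv (grad q u) d)
            - (L / 2 * dotv d d) * t ^+ 2.
pose dk t := sg * (dotv (grad q (u + t *: d)) d - dotv (grad q u) d)
            - (L / 2 * dotv d d) * (t *+ 2).
have k_deriv (t : R) : is_derive t (1 : R) k (dk t).
  have dline := is_derive_line q u d t (dq _).
  rewrite /k /dk; apply: is_derive_eq.
  rewrite /GRing.scale /=; ring.
have k_le : k 1 <= k 0.
  have [|c c01] := @MVT R k dk 0 1 ltr01 (fun t _ => k_deriv t).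
    by apply: derivable_within_continuous => t _; have [] := k_deriv t.
  move: c01; rewrite in_itv /= => /andP[c_gt0 c_lt1].
  rewrite subr0 mulr1 => kE; rewrite -subr_le0 kE /dk.
  have := dotv_le_enorm (sg *: (grad q (u + c *: d) - grad q u)) d.
  rewrite enormZ; have -> : `|sg| = 1.
    by apply/eqP; rewrite -sqrp_eq1 // real_normK ?num_real // sg1.
  have := lip (u + c *: d) u.
  rewrite addrAC subrr add0r enormZ gtr0_norm // mul1r => lipc.
  rewrite dotvZl dotvDl dotvNl => /le_trans cs.
  rewrite subr_le0; apply: cs.
  rewrite -enorm_sq; have := enorm_ge0 d => d_ge0.
  have := ler_wpM2r d_ge0 lipc; lra.
move: k_le; rewrite /k scale1r scale0r addr0 expr1n expr0n /=; lra.
Qed.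

Lemma descent {m} (q : 'cV[R]_m -> R) (L : R) (u v : 'cV[R]_m) :
  (forall y, differentiable q y) ->
  (forall y y', enorm (grad q y - grad q y') <= L * enorm (y - y')) ->
  q v <= q u + dotv (grad q u) (v - u) + L / 2 * dotv (v - u) (v - u).
Proof.
move=> dq lip.
have := gradient_quadratic_bound q L 1 u (v - u) dq lip (expr1n _ _).
rewrite [u + _]addrC subrK; lra.
Qed.

Lemma edom_fineK {T : Type} (q : T -> \bar R) (u : T) :
  (forall w, q w != -oo%E) -> edom q u -> q u = (fine (q u))%:E.
Proof.
move=> qNy u_dom; rewrite fineK // fin_numE qNy /=.
by move: u_dom; rewrite /edom /= lt_neqAle => /andP[].
Qed.

(** The identity t|u|^2 + (1-t)|v|^2 - |t u + (1-t) v|^2 = t(1-t)|u - v|^2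
    turns convexity of q - mu/2 |.|^2 into the familiar inequality for q. *)
Lemma econvex_strong {m} (mu : R) (q : 'cV[R]_m -> \bar R) (u v : 'cV[R]_m)
    (t : R) :
  (forall w, q w != -oo%E) -> strongly_convex mu q ->
  edom q u -> edom q v -> 0 <= t <= 1 ->
  edom q (t *: u + (1 - t) *: v) /\
  fine (q (t *: u + (1 - t) *: v)) <=
    t * fine (q u) + (1 - t) * fine (q v)
    - mu / 2 * (t * (1 - t)) * dotv (u - v) (u - v).
Proof.
move=> qNoo conv uD vD t01.
have := conv u v t t01.
rewrite (edom_fineK _ _ qNoo uD) (edom_fineK _ _ qNoo vD) /=.
rewrite -!EFinB -!EFinM -EFinD.
have := qNoo (t *: u + (1 - t) *: v).
rewrite /edom /=.
case: (q _) => [r| |] //= _.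
rewrite -EFinB lee_fin => conv_le; split; first exact: ltry.
move: conv_le; rewrite !enorm_sq !dotvE (dotvC v u); lra.
Qed.

Lemma strongly_convex0 {m} (q : 'cV[R]_m -> \bar R) :
  econvex q -> strongly_convex 0 q.
Proof.
by move=> conv u v t t01; rewrite !mul0r !sube0; exact: conv.
Qed.

(** The lower quadratic bound on q near u replaces the limit of difference
    quotients: it gives a quadratic inequality in t to which
    [ge0_of_quadratic] applies. *)
Lemma strong_first_order {m} (mu L : R) (q : 'cV[R]_m -> R) (u v : 'cV[R]_m) :
  strongly_convex mu (EFin \o q) ->
  (forall y, differentiable q y) ->
  (forall y y', enorm (grad q y - grad q y') <= L * enorm (y - y')) ->
  q u + dotv (grad q u) (v - u) + mu / 2 * dotv (v - u) (v - u) <= q v.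
Proof.
move=> conv dq lip; rewrite -subr_ge0.
apply: (ge0_of_quadratic _ (mu / 2 * dotv (v - u) (v - u)
                            + L / 2 * dotv (v - u) (v - u))) => t t01.
have t01' : 0 <= t <= 1 by case/andP: t01 => /ltW -> ->.
have [_] := econvex_strong mu (EFin \o q) v u t (fun=> isT) conv (ltry _)
  (ltry _) t01'.
rewrite /=; have -> : t *: v + (1 - t) *: u = u + t *: (v - u).
  by rewrite scalerBl scale1r scalerBr addrCA.
have := gradient_quadratic_bound q L (-1) u (t *: (v - u)) dq lip.
rewrite sqrrN expr1n => /(_ erefl).
rewrite !(@dotvZl, @dotvZr); lra.
Qed.

(** A gradient step of length 1/L from v, for the function minus its
    linearization at u, decreases it by at least |D|^2 / (2L), while this
    function stays nonnegative by convexity. *)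
Lemma gradient_cocoercive {m} (L : R) (q : 'cV[R]_m -> R) (u v : 'cV[R]_m) :
  0 < L -> econvex (EFin \o q) ->
  (forall y, differentiable q y) ->
  (forall y y', enorm (grad q y - grad q y') <= L * enorm (y - y')) ->
  q u + dotv (grad q u) (v - u)
    + (2 * L)^-1 * dotv (grad q v - grad q u) (grad q v - grad q u) <= q v.
Proof.
move=> L_gt0 conv dq lip.
set D := grad q v - grad q u; pose e := L^-1 *: D.
have lo := strong_first_order 0 L q u (v - e) (strongly_convex0 _ conv) dq lip.
have up := descent q L v (v - e) dq lip.
have DD : dotv D D = dotv (grad q v) D - dotv (grad q u) D.
  by rewrite {1}/D dotvDl dotvNl.
have ve : v - e - v = - e by rewrite addrAC subrr add0r.
have ue : v - e - u = (v - u) - e by rewrite addrAC.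
move: lo up; rewrite ve ue !mul0r addr0 [dotv _ (v - u - e)]dotvDr.
rewrite !(@dotvNl, @dotvNr) opprK /e !(@dotvZr, @dotvZl).
have -> : L / 2 * (L^-1 * (L^-1 * dotv D D)) = (2 * L)^-1 * dotv D D.
  by field; rewrite gt_eqF.
have -> : (2 * L)^-1 * dotv D D = L^-1 * dotv D D / 2.
  by field; rewrite gt_eqF.
rewrite DD; lra.
Qed.

End calculus.

(** * Nearest points of a closed convex set *)

Section projection.
Context {R : realType} {n : nat}.
Variable K : set 'cV[R]_n.
Hypothesis K_neq0 : K !=set0.
Hypothesis K_closed : closed K.
Hypothesis K_convex : convex_set (K : set (convex_lmodType 'cV[R]_n)).

Lemma trmx_continuous : continuous (fun v : 'rV[R]_n => v^T : 'cV[R]_n).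
Proof.
move=> /= v S /= /(nbhs_ballP (v^T)) [e e_gt0 eS].
apply/nbhs_ballP; exists e => //= w [_ vw]; apply: eS.
by split=> // i j; rewrite !mxE.
Qed.

Lemma coord_le_enorm (u : 'cV[R]_n) (i : 'I_n) : `|u i 0| <= enorm u.
Proof.
rewrite -sqrtr_sqr; apply: ler_wsqrtr.
rewrite /dotv (bigD1 i) //= -expr2 lerDl.
by apply: sumr_ge0 => j _; rewrite -expr2 sqr_ge0.
Qed.

(** The points of K no farther from u than a given one form a compact set.  The
    compactness criterion is for row vectors, hence the transposes. *)
Lemma nearest_point_exists (u : 'cV[R]_n) :
  exists2 p, K p &
    forall r, K r -> dotv (u - p) (u - p) <= dotv (u - r) (u - r).
Proof.
have [r0 Kr0] := K_neq0.
pose F (v : 'rV[R]_n) := dotv (u - v^T) (u - v^T).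
have F_cont : continuous F.
  apply: continuous_big => [|i _ v].
    by move=> p; apply: cvgD; [exact: cvg_fst | exact: cvg_snd].
  have coordE : (fun v : 'rV[R]_n => (u - v^T) i 0) = (fun v => u i 0 - v 0 i).
    by apply/funext => w; rewrite !mxE.
  have coord_cont : {for v, continuous (fun v : 'rV[R]_n => (u - v^T) i 0)}.
    rewrite coordE; apply: (@continuousB _ _ _ (cst (u i 0))).
      exact: cst_continuous.
    exact: coord_continuous.
  exact: (continuousM coord_cont coord_cont).
pose A := [set v : 'rV[R]_n | K v^T] `&` [set v | F v <= F r0^T].
have A_closed : closed A.
  apply: closedI.
    by apply: (@closed_comp _ _ _ K) => // v _; exact: trmx_continuous.
  apply: (@closed_comp _ _ F [set x | x <= F r0^T]); last exact: closed_le.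
  by move=> v _; exact: F_cont.
have A_bounded : bounded_set A.
  exists (enorm u + enorm (u - r0)); split; first exact: num_real.
  move=> M M_gt v [_ /= Fv].
  apply: le_trans (ltW M_gt).
  rewrite [leLHS]/Num.norm /= mx_normrE; apply: bigmax_le.
    by rewrite addr_ge0 ?enorm_ge0.
  move=> [i j] _ /=; rewrite (ord1 i).
  have -> : v 0 j = u j 0 - (u - v^T) j 0 by rewrite !mxE subKr.
  apply: le_trans (ler_normB _ _) _; apply: lerD; first exact: coord_le_enorm.
  apply: le_trans (coord_le_enorm _ _) _.
  by rewrite enorm_le; move: Fv; rewrite /F trmxK.
have A_neq0 : A !=set0.
  by exists r0^T; split; rewrite /= ?trmxK.
have [p] := EVT_min_rV A_neq0 (bounded_closed_compact A_bounded A_closed)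
  (continuous_subspaceT F_cont).
rewrite inE => -[/= Kp Fp] p_min; exists p^T => // r Kr.
have [Fr|Fr] := leP (F r^T) (F r0^T).
  have := p_min r^T; rewrite inE /F trmxK; apply.
  by split; rewrite /= ?trmxK.
by move: (le_trans Fp (ltW Fr)); rewrite /F trmxK.
Qed.

(** First-order optimality of the nearest point along segments inside K. *)
Lemma projection_exists :
  {P : 'cV[R]_n -> 'cV[R]_n | forall u, K (P u) /\
     forall r, K r -> dotv (u - P u) (r - P u) <= 0}.
Proof.
suff ex u : exists p, K p /\ forall r, K r -> dotv (u - p) (r - p) <= 0.
  by exists (fun u => sval (cid (ex u))) => u; case: cid.
have [p Kp p_min] := nearest_point_exists u.
exists p; split=> // r Kr.
rewrite -oppr_ge0.
apply: (ge0_of_quadratic _ (dotv (r - p) (r - p) / 2)) => t /andP[t_gt0 t_le1].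
have Kt : K (p + t *: (r - p)).
  have t01 : 0 <= t <= 1 by rewrite ltW.
  have := K_convex r p (Itv01 (ltW t_gt0) t_le1).
  rewrite !inE => /(_ Kr Kp).
  suff -> : p + t *: (r - p) = t *: r + (1 - t) *: p by [].
  by rewrite scalerBl scale1r scalerBr addrCA.
have := p_min _ Kt; rewrite opprD addrA.
move: (u - p) (r - p) => a b; rewrite !dotvE (dotvC b a); lra.
Qed.

End projection.

(** * The squared distance as a smooth penalty *)

Section penalty.
Context {R : realType} {n p1 p2 : nat}.
Variables (A : 'M[R]_(n, p1)) (B : 'M[R]_(n, p2)) (c : 'cV[R]_n).
Variables (K : set 'cV[R]_n) (P : 'cV[R]_n -> 'cV[R]_n).
Hypothesis projP : forall u, K (P u) /\
  forall r, K r -> dotv (u - P u) (r - P u) <= 0.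

(** The gradient at w of half the squared distance to K. *)
Definition offset (w : 'cV[R]_n) : 'cV[R]_n := w - P w.

Lemma offset_min (w r : 'cV[R]_n) :
  K r -> dotv (offset w) (offset w) <= dotv (w - r) (w - r).
Proof.
move=> Kr; have := (projP w).2 r Kr; rewrite /offset.
have -> : w - r = (w - P w) - (r - P w) by rewrite opprB addrA subrK.
move: (w - P w) (r - P w) => a b.
have := dotvv_ge0 b; rewrite !dotvE (dotvC b a); lra.
Qed.

Lemma offset_eq0 (w : 'cV[R]_n) : K w -> offset w = 0.
Proof.
move=> /(offset_min w); rewrite subrr dotv0l => off_le0.
by apply/dotvv_eq0/le_anti; rewrite off_le0 dotvv_ge0.
Qed.

Lemma dist_toE (w : 'cV[R]_n) : dist_to K w = enorm (offset w).
Proof.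
have lb : lbound [set enorm (w - r) | r in K] (enorm (offset w)).
  by move=> _ [r Kr <-]; rewrite enorm_le offset_min.
have mem : [set enorm (w - r) | r in K] (enorm (offset w)).
  by exists (P w) => //; exact: (projP w).1.
apply/le_anti/andP; split.
  by apply: ge_inf => //; exists (enorm (offset w)).
by apply: lb_le_inf => //; exists (enorm (offset w)).
Qed.

Lemma psi_dist x y : psi A B c K x y = 2^-1 * dist_to K (resid A B c x y) ^+ 2.
Proof. by []. Qed.

Lemma psiE x y :
  psi A B c K x y =
    dotv (offset (resid A B c x y)) (offset (resid A B c x y)) / 2.
Proof. by rewrite psi_dist dist_toE enorm_sq mulrC. Qed.

(** The offset is the gradient of half the squared distance; this is its
    convexity inequality in the sharp, cocoercive form.  The difference of the
    two sides is the inner product of [offset w] with P w - P w', nonnegative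
    because P w' lies in K. *)
Lemma offset_lower (w w' : 'cV[R]_n) :
  dotv (offset w) (offset w) / 2 + dotv (offset w) (w' - w)
    + dotv (offset w' - offset w) (offset w' - offset w) / 2
  <= dotv (offset w') (offset w') / 2.
Proof.
have := (projP w).2 _ (projP w').1.
have -> : P w' - P w = (w' - w) + offset w - offset w'.
  by rewrite /offset; apply/colP => i; rewrite !mxE; ring.
rewrite -/(offset w); move: (offset w) (offset w') (w' - w) => s s' d.
rewrite !dotvE (dotvC s' s); lra.
Qed.

(** P w is a competitor for the distance from w'. *)
Lemma offset_upper (w w' : 'cV[R]_n) :
  dotv (offset w') (offset w') / 2 <=
    dotv (offset w) (offset w) / 2 + dotv (offset w) (w' - w)
    + dotv (w' - w) (w' - w) / 2.
Proof.
have := offset_min w' _ (projP w).1.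
have -> : w' - P w = (w' - w) + offset w.
  by rewrite /offset addrA subrK.
move: (offset w) (offset w') (w' - w) => s s' d.
rewrite !dotvE (dotvC s d); lra.
Qed.

Lemma grad_y_psiE x y :
  grad_y_psi A B c K x y = B^T *m offset (resid A B c x y).
Proof.
apply/colP => i; rewrite mxE.
set w := resid A B c x y; set d := delta_mx i 0.
have -> : (B^T *m offset w) i 0 = dotv (offset w) (B *m d).
  rewrite dotvC dot_mulmx /dotv (bigD1 i) //= big1 => [|j ji].
    by rewrite [d i 0]mxE !eqxx mul1r addr0.
  by rewrite [d j 0]mxE (negbTE ji) mul0r.
apply: (derive_of_quadratic _ _ _ _ (dotv (B *m d) (B *m d) / 2)) => t.
rewrite !psiE -/w.
have -> : resid A B c x (y + t *: d) = w + t *: (B *m d).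
  by rewrite /w /resid mulmxDr -scalemxAr addrA (addrAC _ _ (- c)).
have := offset_upper w (w + t *: (B *m d)).
have := offset_lower w (w + t *: (B *m d)).
have := dotvv_ge0 (offset (w + t *: (B *m d)) - offset w).
have -> : w + t *: (B *m d) - w = t *: (B *m d) by rewrite addrAC subrr add0r.
have := dotvv_ge0 (t *: (B *m d)).
rewrite !(@dotvZl, @dotvZr) => ? ? ? ?.
by rewrite ler_norml; apply/andP; split; rewrite expr2; lra.
Qed.

End penalty.

(** * Optimality conditions for proximal steps *)

Section minimizers.
Context {R : realType}.

Lemma argmin_edom {T : Type} (q : T -> \bar R) (r : T -> R) (u : T) :
  proper_function q -> argmin (fun w => q w + (r w)%:E)%E u -> edom q u.
Proof.
move=> [qNy [v v_dom]] /(_ v) u_min; rewrite /edom /=.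
have : (q u + (r u)%:E < +oo)%E.
  by apply: le_lt_trans u_min _; rewrite lte_add_pinfty // ltry.
by case: (q u) (qNy u) => // x _ _; rewrite ltry.
Qed.

(** The minimizer u of q + r is compared with u + t (v - u).  Only an upper
    quadratic bound on r along the segment is needed, not its gradient. *)
Lemma argmin_variational {m} (mu : R) (q : 'cV[R]_m -> \bar R)
    (r : 'cV[R]_m -> R) (u v : 'cV[R]_m) (a C : R) :
  proper_function q -> strongly_convex mu q ->
  argmin (fun w => q w + (r w)%:E)%E u -> edom q v ->
  (forall t, 0 < t <= 1 -> r (u + t *: (v - u)) <= r u + t * a + C * t ^+ 2) ->
  fine (q u) + mu / 2 * dotv (u - v) (u - v) <= fine (q v) + a.
Proof.
move=> q_proper q_conv u_min v_dom r_le.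
have u_dom := argmin_edom _ _ _ q_proper u_min.
rewrite -subr_ge0.
apply: (ge0_of_quadratic _ (mu / 2 * dotv (u - v) (u - v) + C)) => t t01.
have t01' : 0 <= t <= 1 by case/andP: t01 => /ltW -> ->.
have wE : t *: v + (1 - t) *: u = u + t *: (v - u).
  by rewrite scalerBl scale1r scalerBr addrCA.
have := econvex_strong mu q v u t q_proper.1 q_conv v_dom u_dom t01'.
rewrite wE => -[w_dom].
have := r_le t t01.
have := u_min (u + t *: (v - u)).
rewrite (edom_fineK _ _ q_proper.1 u_dom) (edom_fineK _ _ q_proper.1 w_dom) /=.
rewrite -!EFinD lee_fin -(opprB u v) !(@dotvNl, @dotvNr) opprK; lra.
Qed.

(** The prox of a gradient step at w minimizes q plus the linearization G plus
    b/2 |. - w|^2; the inner product between u - w and u - v that comes out of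
    the optimality condition is polarized into squares. *)
Lemma prox_three_point {m} (mu b : R) (q : 'cV[R]_m -> \bar R)
    (w G u v : 'cV[R]_m) :
  proper_function q -> strongly_convex mu q -> 0 < b ->
  is_prox (1 / b) q (w - (1 / b) *: G) u -> edom q v ->
  fine (q u) + dotv G (u - v)
    + b / 2 * (dotv (u - w) (u - w) + dotv (u - v) (u - v)
               - dotv (v - w) (v - w))
    + mu / 2 * dotv (u - v) (u - v)
  <= fine (q v).
Proof.
move=> q_proper q_conv b_gt0 u_prox v_dom.
have b2 : 1 / (2 * (1 / b)) = b / 2 by field; rewrite gt_eqF.
have b1 : b * (1 / b) = 1 by field; rewrite gt_eqF.
have vw : v - w = (u - w) + (v - u) by rewrite [RHS]addrC subrKA.
pose r (x : 'cV[R]_m) :=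
  1 / (2 * (1 / b)) * enorm (x - (w - (1 / b) *: G)) ^+ 2.
have r_quad t : 0 < t <= 1 -> r (u + t *: (v - u)) <=
    r u + t * dotv (b *: (u - w) + G) (v - u)
    + b / 2 * dotv (v - u) (v - u) * t ^+ 2.
  move=> _; rewrite /r.
  rewrite b2 !enorm_sq !opprD !opprK.
  have -> : u + t *: (v - u) + (- w + (1 / b) *: G)
      = (u - w) + t *: (v - u) + (1 / b) *: G.
    by apply/colP => i; rewrite !mxE; ring.
  rewrite addrA.
  move: (u - w) (v - u) => d e.
  rewrite !dotvE (dotvC e d) (dotvC G d) (dotvC e G).
  move: (1 / b) b1 => bi b1.
  have bG : t * dotv G e = t * dotv G e * (b * bi) by rewrite b1 mulr1.
  lra.
have := argmin_variational mu q r u v _ _ q_proper q_conv u_prox v_dom r_quad.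
rewrite vw -(opprB v u).
move: (u - w) (v - u) => d e; rewrite !dotvE (dotvC e d); lra.
Qed.

End minimizers.

(** * Extrapolation and step-size sequences *)

Section extrapolation.
Context {R : realType} {p : nat}.
Variables (tau : nat -> R) (x xh : nat -> 'cV[R]_p).
Hypothesis tau_gt0 : forall k, 0 < tau k.

(** The extrapolated point and the next iterate are both convex combinations,
    with weight tau, of the current iterate and of one of these points; their
    distance to the solution enters the potential. *)
Definition anchor (k : nat) : 'cV[R]_p :=
  if k is j.+1 then x j + (tau j)^-1 *: (x j.+1 - x j) else x 0%N.

Lemma anchorS (k : nat) : x k.+1 = (1 - tau k) *: x k + tau k *: anchor k.+1.
Proof.
by apply/colP => i; rewrite !mxE; field; rewrite gt_eqF.
Qed.

Lemma extrapolation_anchor (k : nat) :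
  xh 0%N = x 0%N ->
  (forall k, xh k.+1 =
     x k.+1 + (tau k.+1 * (1 - tau k) / tau k) *: (x k.+1 - x k)) ->
  xh k = (1 - tau k) *: x k + tau k *: anchor k.
Proof.
case: k => [|k] xh0 xhS; first by rewrite xh0 -scalerDl subrK scale1r.
rewrite xhS /=; apply/colP => i; rewrite !mxE; field.
by rewrite gt_eqF.
Qed.

End extrapolation.

Section rates.
Context {R : realType}.

(** The weights are chosen so that [cc k * (1 - tau k)] is the previous weight;
    since tau_0 = 1, the gap at the starting point does not enter. *)
Lemma lyapunov_decrease (E cc tau S S' : nat -> R) :
  tau 0%N = 1 ->
  (forall k, cc k.+1 * (1 - tau k.+1) = cc k) ->
  (forall k, cc k * E k.+1 + S' k <= cc k * ((1 - tau k) * E k) + S k) ->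
  (forall k, S k.+1 <= S' k) ->
  forall k, cc k * E k.+1 + S' k <= S 0%N.
Proof.
move=> tau0 ccS step SS'; elim=> [|k IH]; apply: le_trans (step _) _.
  by rewrite tau0 subrr mul0r mulr0 add0r.
by rewrite mulrA ccS; apply: le_trans IH; rewrite lerD2l.
Qed.

Variable tau : nat -> R.
Hypothesis tau0 : tau 0%N = 1.
Hypothesis tauS :
  forall k, tau k.+1 = tau k / 2 * (Num.sqrt (tau k ^+ 2 + 4) - tau k).

Lemma tau_step (a : R) (b := a / 2 * (Num.sqrt (a ^+ 2 + 4) - a)) :
  0 < a <= 1 -> [/\ 0 < b, b <= a, a / 2 <= b & b ^+ 2 = (1 - b) * a ^+ 2].
Proof.
move=> /andP[a_gt0 a_le1]; rewrite /b.
have := sqrtr_ge0 (a ^+ 2 + 4).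
have : Num.sqrt (a ^+ 2 + 4) ^+ 2 = a ^+ 2 + 4.
  by rewrite sqr_sqrtr // addr_ge0 // sqr_ge0.
move: (Num.sqrt _) => r rr r_ge0.
have r_lo : a + 1 <= r by rewrite -ler_sqr ?nnegrE //; nra.
have r_up : r <= a + 2 by rewrite -ler_sqr ?nnegrE //; nra.
by split; nra.
Qed.

Lemma tau_itv (k : nat) : 0 < tau k <= 1.
Proof.
elim: k => [|k IH]; first by rewrite tau0 ltr01 lexx.
have [b_gt0 b_le _ _] := tau_step _ IH.
by rewrite tauS b_gt0 (le_trans b_le) //; case/andP: IH.
Qed.

Lemma tau_gt0 (k : nat) : 0 < tau k. Proof. by case/andP: (tau_itv k). Qed.

Lemma tau_half (k : nat) : tau k / 2 <= tau k.+1.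
Proof. by rewrite tauS; have [] := tau_step _ (tau_itv k). Qed.

Lemma tau_sqS (k : nat) : tau k.+1 ^+ 2 = (1 - tau k.+1) * tau k ^+ 2.
Proof. by rewrite tauS; have [] := tau_step _ (tau_itv k). Qed.

(** From tau_{k+1} ^ 2 = (1 - tau_{k+1}) tau_k ^ 2 one gets
    1 / tau_{k+1} >= 1 / tau_k + 1 / 2. *)
Lemma tau_le (k : nat) : k.+2%:R * tau k <= 2.
Proof.
elim: k => [|k IH]; first by rewrite tau0 mulr1.
have a_gt0 := tau_gt0 k; have b_gt0 := tau_gt0 k.+1.
have sqS := tau_sqS k.
have b_le : tau k.+1 <= tau k.
  by rewrite tauS; have [] := tau_step _ (tau_itv k).
move: (tau k) (tau k.+1) a_gt0 b_gt0 sqS b_le IH => a b a_gt0 b_gt0 sqS b_le IH.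
have ba : b * (2 + a) <= 2 * a.
  rewrite -(ler_pM2l a_gt0).
  have : (a - b) * (a + b) = a ^+ 2 * b by lra.
  nra.
have a2 : 0 < 2 + a by lra.
rewrite -(ler_pM2r a2) -mulrA.
apply: le_trans (ler_wpM2l _ ba) _; first exact: ler0n.
move: IH; rewrite -(natr1 k.+2) => IH; lra.
Qed.

End rates.

(** * Descent in one iteration *)

Section weighted_squares.
Context {R : realType} {m : nat}.

(** The difference is |s - (1 - t) a|^2.  With a the offset at the current
    iterate and s the offset at the intermediate point, the left-hand side is
    the cost of raising the penalty from (1 - t) rho to rho. *)
Lemma weighted_square2 (a s : 'cV[R]_m) (t : R) :
  t * (1 - t) * dotv a a <= (1 - t) * dotv (a - s) (a - s) + t * dotv s s.
Proof.
have := dotvv_ge0 (s - (1 - t) *: a); rewrite !dotvE (dotvC a s); lra.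
Qed.

(** Convexity of the square with weights 1 - t, t (1 - t) and t ^ 2 at the
    points a, b / t and s / t ^ 2, cleared of denominators. *)
Lemma weighted_square3 (a b s : 'cV[R]_m) (t : R) : 0 <= t <= 1 ->
  t ^+ 2 * dotv ((1 - t) *: (a + b) + s) ((1 - t) *: (a + b) + s)
  <= t ^+ 2 * (1 - t) * dotv a a + t * (1 - t) * dotv b b + dotv s s.
Proof.
move=> /andP[t_ge0 t_le1]; rewrite -subr_ge0.
have u_ge0 : 0 <= 1 - t by lra.
have -> : t ^+ 2 * (1 - t) * dotv a a + t * (1 - t) * dotv b b + dotv s s
    - t ^+ 2 * dotv ((1 - t) *: (a + b) + s) ((1 - t) *: (a + b) + s)
  = t * (1 - t) ^+ 2 * dotv (t *: a - b) (t *: a - b)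
    + (1 - t) * dotv (t ^+ 2 *: a - s) (t ^+ 2 *: a - s)
    + t * (1 - t) * dotv (t *: b - s) (t *: b - s).
  rewrite !dotvE (dotvC b a) (dotvC s a) (dotvC s b); ring.
by rewrite !addr_ge0 // !mulr_ge0 ?exprn_ge0 ?dotvv_ge0.
Qed.

Lemma three_point (u v w : 'cV[R]_m) :
  dotv (u - v) (w - u) =
    (dotv (v - w) (v - w) - dotv (u - w) (u - w) - dotv (u - v) (u - v)) / 2.
Proof.
rewrite !dotvE (dotvC v u) (dotvC w u) (dotvC w v); lra.
Qed.

End weighted_squares.

(** Inner products and function values are only scalars for linear arithmetic.
    Naming them keeps [lra] from unfolding the vectors inside them when it
    compares atoms. *)
Ltac lra_dot := repeat match goal with
  | |- context [dotv ?u ?v] => move: (dotv u v) => ?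
  | |- context [fine ?a] => move: (fine a) => ?
  | |- context [Defs.psi ?A ?B ?c ?K ?x ?y] => move: (Defs.psi A B c K x y) => ?
  end; lra.

Section step.
Context {R : realType} {n p1 p2 : nat}.
Variables (f : 'cV[R]_p1 -> \bar R) (g : 'cV[R]_p2 -> \bar R).
Variables (h : 'cV[R]_p2 -> R).
Variables (A : 'M[R]_(n, p1)) (B : 'M[R]_(n, p2)) (c : 'cV[R]_n).
Variables (K : set 'cV[R]_n) (P : 'cV[R]_n -> 'cV[R]_n).
Variables (Lh muh mug : R).
Hypothesis f_proper : proper_function f.
Hypothesis f_convex : econvex f.
Hypothesis g_proper : proper_function g.
Hypothesis g_convex : strongly_convex mug g.
Hypothesis mug_ge0 : 0 <= mug.
Hypothesis h_convex : econvex (EFin \o h).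
Hypothesis h_strong : strongly_convex muh (EFin \o h).
Hypothesis h_diff : forall y, differentiable h y.
Hypothesis Lh_gt0 : 0 < Lh.
Hypothesis h_lip :
  forall y y', enorm (grad h y - grad h y') <= Lh * enorm (y - y').
Hypothesis projP : forall u, K (P u) /\
  forall r, K r -> dotv (u - P u) (r - P u) <= 0.

Local Notation res := (resid A B c).
Local Notation psi := (psi A B c K).
Local Notation off := (offset P).

Lemma residB (x u : 'cV[R]_p1) (y v : 'cV[R]_p2) :
  res u v - res x y = A *m (u - x) + B *m (v - y).
Proof. by rewrite /resid !mulmxBr; apply/colP => i; rewrite !mxE; ring. Qed.

Lemma h_first_order (u v : 'cV[R]_p2) :
  h u + dotv (grad h u) (v - u) <= h v.
Proof.
have := strong_first_order 0 Lh h u v (strongly_convex0 _ h_convex) h_diff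
  h_lip.
by rewrite mul0r mul0r addr0.
Qed.

Lemma g_convex_le (u v : 'cV[R]_p2) (t : R) : 0 <= t <= 1 ->
  edom g u -> edom g v ->
  edom g ((1 - t) *: u + t *: v) /\
  fine (g ((1 - t) *: u + t *: v)) <= (1 - t) * fine (g u) + t * fine (g v).
Proof.
move=> /andP[t_ge0 t_le1] uD vD.
have t01 : 0 <= 1 - t <= 1 by apply/andP; split; lra_dot.
have := econvex_strong mug g u v (1 - t) g_proper.1 g_convex uD vD t01.
rewrite opprB addrCA subrr addr0 => -[wD conv_le]; split=> //.
apply: le_trans conv_le _; rewrite gerBl mulr_ge0 ?dotvv_ge0 //.
by rewrite mulr_ge0 ?divr_ge0 // mulr_ge0 // subr_ge0.
Qed.

Section x_update.
Variables (rho gam : R) (xh xp : 'cV[R]_p1) (yh : 'cV[R]_p2).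
Hypothesis rho_ge0 : 0 <= rho.
Hypothesis xp_min : argmin
  (fun u => f u + (rho * psi u yh + gam / 2 * enorm (u - xh) ^+ 2)%:E)%E xp.

Local Notation s := (off (res xp yh)).

Lemma x_update_variational (u : 'cV[R]_p1) : edom f u ->
  fine (f xp) <= fine (f u) + rho * dotv s (A *m (u - xp))
                 + gam * dotv (xp - xh) (u - xp).
Proof.
move=> u_dom.
have conv0 := strongly_convex0 _ f_convex.
pose r u := rho * psi u yh + gam / 2 * enorm (u - xh) ^+ 2.
have r_quad t : 0 < t <= 1 -> r (xp + t *: (u - xp)) <= r xp
    + t * (rho * dotv s (A *m (u - xp)) + gam * dotv (xp - xh) (u - xp))
    + (rho / 2 * dotv (A *m (u - xp)) (A *m (u - xp))
       + gam / 2 * dotv (u - xp) (u - xp)) * t ^+ 2.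
  move=> _; rewrite /r !enorm_sq !(psiE _ _ _ _ _ projP).
  have := offset_upper _ _ projP (res xp yh) (res (xp + t *: (u - xp)) yh).
  rewrite residB subrr mulmx0 addr0.
  have -> : xp + t *: (u - xp) - xp = t *: (u - xp).
    by rewrite addrAC subrr add0r.
  rewrite (addrAC xp) -scalemxAr !(@dotvZl, @dotvZr).
  move=> /(ler_wpM2l rho_ge0).
  move: (off (res (xp + t *: (u - xp)) yh)) s (A *m (u - xp)) => s' s0 v.
  move: (xp - xh) (u - xp) => d e; rewrite !dotvE (dotvC e d); lra_dot.
have := argmin_variational 0 f r xp u _ _ f_proper conv0 xp_min u_dom r_quad.
lra_dot.
Qed.

(** The optimality condition is used at the current iterate with weight 1 - t
    and at the solution with weight t, together with [offset_lower] at the same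
    two points.  At the solution the offset vanishes, so cocoercivity leaves
    |s|^2 there and |a - s|^2 at the iterate, and [weighted_square2] lowers the
    penalty on the right to (1 - t) rho. *)
Lemma x_update_descent (t : R) (x xt xtp xs : 'cV[R]_p1) (y ys : 'cV[R]_p2) :
  0 <= t <= 1 -> 0 <= gam -> edom f x -> edom f xs -> K (res xs ys) ->
  xh = (1 - t) *: x + t *: xt -> xp = (1 - t) *: x + t *: xtp ->
  fine (f xp) + rho * psi xp yh
    + rho * dotv s (B *m ((1 - t) *: y + t *: ys - yh))
    + t ^+ 2 * (gam / 2 * dotv (xtp - xs) (xtp - xs))
  <= (1 - t) * (fine (f x) + (1 - t) * rho * psi x y) + t * fine (f xs)
     + t ^+ 2 * (gam / 2 * dotv (xt - xs) (xt - xs)).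
Proof.
move=> /andP[t_ge0 t_le1] gam_ge0 x_dom xs_dom feas xhE xpE.
have u_ge0 : 0 <= 1 - t by lra_dot.
rewrite !(psiE _ _ _ _ _ projP).
have := ler_wpM2l u_ge0 (x_update_variational x x_dom).
have := ler_wpM2l t_ge0 (x_update_variational xs xs_dom).
have := offset_lower _ _ projP (res xp yh) (res x y).
move=> /(ler_wpM2l rho_ge0)/(ler_wpM2l u_ge0).
have := offset_lower _ _ projP (res xp yh) (res xs ys).
move=> /(ler_wpM2l rho_ge0)/(ler_wpM2l t_ge0).
have -> : off (res xs ys) = 0 by exact: offset_eq0 projP _ feas.
rewrite !residB sub0r !(@dotvNl, @dotvNr) opprK dotv0l.
rewrite !(dotvDr (A *m _)).
have -> : dotv s (B *m ((1 - t) *: y + t *: ys - yh)) =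
    (1 - t) * dotv s (B *m (y - yh)) + t * dotv s (B *m (ys - yh)).
  rewrite -!dotvZr -dotvDr !scalemxAr -mulmxDr; congr (dotv _ (_ *m _)).
  by apply/colP => i; rewrite !mxE; ring.
have := weighted_square2 (off (res x y)) s t.
move=> /(ler_wpM2l rho_ge0).
have prox_sum : (1 - t) * dotv (xp - xh) (x - xp) + t * dotv (xp - xh) (xs - xp)
    <= t ^+ 2 / 2 * (dotv (xt - xs) (xt - xs) - dotv (xtp - xs) (xtp - xs)).
  have -> : (1 - t) * dotv (xp - xh) (x - xp) + t * dotv (xp - xh) (xs - xp)
      = t ^+ 2 * dotv (xtp - xt) (xs - xtp).
    have -> : xp - xh = t *: (xtp - xt).
      by rewrite xpE xhE; apply/colP => i; rewrite !mxE; ring.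
    have -> : x - xp = t *: (x - xtp).
      by rewrite xpE; apply/colP => i; rewrite !mxE; ring.
    have -> : xs - xp = t *: (xs - xtp) + (1 - t) *: (xs - x).
      by rewrite xpE; apply/colP => i; rewrite !mxE; ring.
    rewrite !dotvE; ring.
  rewrite -mulrA; apply: ler_wpM2l; first exact: exprn_ge0.
  have := dotvv_ge0 (xtp - xt); rewrite three_point; lra_dot.
have := ler_wpM2l gam_ge0 prox_sum.
lra_dot.
Qed.

End x_update.

(** What a y-update must achieve to complement [x_update_descent]: the model
    value rho psi(xp, yh) and the inner product with the offset cancel when the
    two inequalities are added.  [Psi] and [Psi'] are the potentials before and
    after the update. *)
Definition y_descent (rho t : R) (xp : 'cV[R]_p1) (y yh yp ys : 'cV[R]_p2)
    (Psi Psi' : R) : Prop :=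
  fine (g yp) + h yp + rho * psi xp yp + t ^+ 2 * Psi'
  <= rho * psi xp yh + (1 - t) * (fine (g y) + h y) + t * (fine (g ys) + h ys)
     + rho * dotv (off (res xp yh)) (B *m ((1 - t) *: y + t *: ys - yh))
     + t ^+ 2 * Psi.

Section y_update.
Variables (rho t : R) (xp : 'cV[R]_p1) (y yt yh yp ytp ys : 'cV[R]_p2).
Hypothesis rho_ge0 : 0 <= rho.
Hypothesis t01 : 0 < t <= 1.
Hypothesis y_dom : edom g y.
Hypothesis ys_dom : edom g ys.
Hypothesis yhE : yh = (1 - t) *: y + t *: yt.

Local Notation s := (off (res xp yh)).
Local Notation G := (grad h yh + rho *: (B^T *m s)).
Local Notation bb := (rho * opnorm B ^+ 2 + Lh).

Let bb_gt0 : 0 < bb.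
Proof. by rewrite ltr_wpDl // mulr_ge0 // exprn_ge0 // opnorm_ge0. Qed.

Let t_gt0 : 0 < t. Proof. by case/andP: t01. Qed.
Let t_le1 : t <= 1. Proof. by case/andP: t01. Qed.
Let t01' : 0 <= t <= 1. Proof. by rewrite ltW. Qed.

Lemma smooth_model (v : 'cV[R]_p2) :
  h v + rho * psi xp v <=
    h yh + rho * psi xp yh + dotv G (v - yh) + bb / 2 * dotv (v - yh) (v - yh).
Proof.
rewrite !(psiE _ _ _ _ _ projP) dotvDl dotvZl.
rewrite (dotvC (B^T *m _)) -dot_mulmx (dotvC (B *m _)).
have := descent h Lh yh v h_diff h_lip.
have := offset_upper _ _ projP (res xp yh) (res xp v).
rewrite residB subrr mulmx0 add0r => /(ler_wpM2l rho_ge0).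
have := ler_wpM2l rho_ge0 (dotv_mulmx_le B (v - yh)).
lra_dot.
Qed.

(** The term bb/2 |yp - yp'|^2 on the left comes from strong convexity of the
    prox objective; it is what makes the comparison useful when yp differs from
    the convex combination of earlier points. *)
Lemma prox_gradient_descent (yp' : 'cV[R]_p2) :
  is_prox (1 / bb) g (yh - (1 / bb) *: G) yp -> edom g yp' ->
  fine (g yp) + h yp + rho * psi xp yp + bb / 2 * dotv (yp - yp') (yp - yp') <=
    fine (g yp') + h yh + rho * psi xp yh
    + dotv G (yp' - yh) + bb / 2 * dotv (yp' - yh) (yp' - yh).
Proof.
move=> yp_prox yp'_dom.
have := prox_three_point mug bb g yh G yp yp' g_proper g_convex bb_gt0 yp_prox
  yp'_dom.
have := smooth_model yp.
have -> : dotv G (yp - yp') = dotv G (yp - yh) - dotv G (yp' - yh).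
  by rewrite -dotvNr -dotvDr opprB subrKA.
have : 0 <= mug / 2 * dotv (yp - yp') (yp - yp').
  by rewrite mulr_ge0 ?divr_ge0 ?dotvv_ge0.
lra_dot.
Qed.

Lemma dotG (v : 'cV[R]_p2) :
  dotv G v = dotv (grad h yh) v + rho * dotv s (B *m v).
Proof.
by rewrite dotvDl dotvZl (dotvC (B^T *m _)) -dot_mulmx (dotvC (B *m _)).
Qed.

Lemma h_linearization_le :
  h yh + dotv (grad h yh) ((1 - t) *: y + t *: ys - yh)
  <= (1 - t) * h y + t * h ys.
Proof.
have u_ge0 : 0 <= 1 - t by rewrite subr_ge0.
have := ler_wpM2l u_ge0 (h_first_order yh y).
have := ler_wpM2l (ltW t_gt0) (h_first_order yh ys).
rewrite !(@dotvDr, @dotvZr, @dotvNr); lra_dot.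
Qed.

Lemma y_update_prox :
  is_prox (1 / bb) g (yh - (1 / bb) *: G) yp ->
  yp = (1 - t) *: y + t *: ytp ->
  y_descent rho t xp y yh yp ys
    (bb / 2 * dotv (yt - ys) (yt - ys)) (bb / 2 * dotv (ytp - ys) (ytp - ys)).
Proof.
rewrite /y_descent => yp_prox ypE.
have [v_dom v_le] := g_convex_le y ys t t01' y_dom ys_dom.
have := prox_gradient_descent _ yp_prox v_dom.
have := h_linearization_le.
rewrite dotG.
have -> : yp - ((1 - t) *: y + t *: ys) = t *: (ytp - ys).
  by rewrite ypE; apply/colP => i; rewrite !mxE; ring.
have -> : dotv ((1 - t) *: y + t *: ys - yh) ((1 - t) *: y + t *: ys - yh)
    = t ^+ 2 * dotv (yt - ys) (yt - ys).
  have -> : (1 - t) *: y + t *: ys - yh = - (t *: (yt - ys)).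
    by rewrite yhE; apply/colP => i; rewrite !mxE; ring.
  rewrite !(@dotvNl, @dotvNr, @dotvZl, @dotvZr); ring.
rewrite !(@dotvZl, @dotvZr); move: v_le; lra_dot.
Qed.

Let y1 := (1 - t) *: y + t *: ytp.

(** Both options satisfy the same inequality, with y1 the averaged point: in the
    first yp is y1, in the second yp beats y1 in the quadratic model. *)
Lemma y_update_options :
  edom g ytp ->
  yp = y1 \/ is_prox (1 / bb) g (yh - (1 / bb) *: G) yp ->
  fine (g yp) + h yp + rho * psi xp yp + bb / 2 * dotv (yp - y1) (yp - y1) <=
    (1 - t) * fine (g y) + t * fine (g ytp) + h yh + rho * psi xp yh
    + t * dotv G (ytp - yt) + t ^+ 2 * (bb / 2 * dotv (ytp - yt) (ytp - yt)).
Proof.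
move=> ytp_dom opt.
have [y1_dom y1_le] := g_convex_le y ytp t t01' y_dom ytp_dom.
have y1h : y1 - yh = t *: (ytp - yt).
  by rewrite yhE /y1; apply/colP => i; rewrite !mxE; ring.
suff : fine (g yp) + h yp + rho * psi xp yp
    + bb / 2 * dotv (yp - y1) (yp - y1) <=
    fine (g y1) + h yh + rho * psi xp yh
    + dotv G (y1 - yh) + bb / 2 * dotv (y1 - yh) (y1 - yh).
  rewrite y1h !(@dotvZl, @dotvZr); move: y1_le; rewrite -/y1; lra_dot.
case: opt => [->|yp_prox]; last exact: prox_gradient_descent.
have := smooth_model y1.
clear y1_le; rewrite [y1 - y1]subrr dotv0l mulr0 addr0.
by move: (h y1) => h1; lra_dot.
Qed.

Lemma y_update_strong_g (bh : R) :
  bh = bb ->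
  is_prox (1 / (t * bh)) g (yt - (1 / (t * bh)) *: G) ytp ->
  yp = y1 \/ is_prox (1 / bb) g (yh - (1 / bb) *: G) yp ->
  y_descent rho t xp y yh yp ys
    (bh / 2 * dotv (yt - ys) (yt - ys))
    ((bh + mug / t) / 2 * dotv (ytp - ys) (ytp - ys)).
Proof.
rewrite /y_descent => -> ytp_prox opt.
have ytp_dom := argmin_edom _ _ _ g_proper ytp_prox.
have := prox_three_point mug (t * bb) g yt G ytp ys g_proper g_convex
  (mulr_gt0 t_gt0 bb_gt0) ytp_prox ys_dom.
move=> /(ler_wpM2l (ltW t_gt0)).
have := y_update_options ytp_dom opt.
have := h_linearization_le.
have -> : (1 - t) *: y + t *: ys - yh = t *: (ys - yt).
  by rewrite yhE; apply/colP => i; rewrite !mxE; ring.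
have -> : ytp - ys = (ytp - yt) - (ys - yt) by rewrite opprB subrKA.
rewrite (dotvDr (ytp - yt)) dotvNr (dotG (ys - yt)) -scalemxAr !(dotvZr t).
have -> : dotv (yt - ys) (yt - ys) = dotv (ys - yt) (ys - yt).
  by rewrite -(opprB ys yt) dotvNl dotvNr opprK.
have tmu : t ^+ 2 * (mug / t) = t * mug by field; rewrite gt_eqF.
have : 0 <= bb / 2 * dotv (yp - y1) (yp - y1).
  by rewrite mulr_ge0 ?dotvv_ge0 // divr_ge0 // ltW.
move: (dotv (ytp - yt - (ys - yt)) _) => D.
have -> : t ^+ 2 * ((bb + mug / t) / 2 * D) = (t ^+ 2 * bb + t * mug) / 2 * D.
  by rewrite -tmu; ring.
lra_dot.
Qed.

(** The gradient at yt drives ytp whereas the quadratic model of h is taken at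
    yh.  Write e = y - yt, d = ytp - yt and grad h yh - grad h yt =
    Lh (1 - t) q.  Cocoercivity gives |q|^2 <= <q, e>, that is,
    |e - q|^2 + |q|^2 <= |e|^2, and a negative multiple of |d - q|^2 is left
    over.  Since yp - ytp = (1 - t) ((e - q) + (q - d)) + (yp - y1),
    [weighted_square3] bounds the new |yp - ytp|^2 by these terms. *)
Lemma linearization_gap :
  h yh + t * dotv (grad h yh) (ytp - yt)
    + t ^+ 2 * (Lh / 2 * dotv (ytp - yt) (ytp - yt))
    + t ^+ 2 * (Lh / 2 * dotv (yp - ytp) (yp - ytp))
  <= (1 - t) * h y + t * h yt + t * dotv (grad h yt) (ytp - yt)
     + t * (Lh / 2 * dotv (ytp - yt) (ytp - yt))
     + t ^+ 2 * (Lh / 2 * dotv (y - yt) (y - yt))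
     + Lh / 2 * dotv (yp - y1) (yp - y1).
Proof.
(* At t = 1 the points yh and yt coincide and q would not be defined. *)
have [t1|t_neq1] := eqVneq t 1.
  rewrite yhE /y1 t1 subrr !scale0r !scale1r !add0r expr1n.
  have : 0 <= Lh / 2 * dotv (y - yt) (y - yt).
    by rewrite mulr_ge0 ?dotvv_ge0 // divr_ge0 // ltW.
  lra_dot.
have u_gt0 : 0 < 1 - t by rewrite subr_gt0 lt_neqAle t_neq1.
pose q := (Lh * (1 - t))^-1 *: (grad h yh - grad h yt).
have gradE : grad h yt = grad h yh - (Lh * (1 - t)) *: q.
  by rewrite scalerA divff ?mulf_neq0 ?gt_eqF // scale1r opprB addrC subrK.
clearbody q.
have Linv : (2 * Lh)^-1 * (Lh * (1 - t)) ^+ 2 = Lh * (1 - t) ^+ 2 / 2.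
  by field; rewrite gt_eqF.
have GG : dotv (grad h yt - grad h yh) (grad h yt - grad h yh)
    = (Lh * (1 - t)) ^+ 2 * dotv q q.
  rewrite gradE addrAC subrr add0r !(@dotvNl, @dotvNr, @dotvZl, @dotvZr); ring.
have := gradient_cocoercive Lh h yh yt Lh_gt0 h_convex h_diff h_lip.
rewrite GG [_^-1 * (_ * _)]mulrA Linv => co1.
have := gradient_cocoercive Lh h yt yh Lh_gt0 h_convex h_diff h_lip.
rewrite -(opprB (grad h yt)) dotvNl dotvNr opprK GG.
rewrite [_^-1 * (_ * _)]mulrA Linv => co2.
have yh_y : y - yh = t *: (y - yt).
  by rewrite yhE; apply/colP => i; rewrite !mxE; ring.
have yh_yt : yt - yh = - ((1 - t) *: (y - yt)).
  by rewrite yhE; apply/colP => i; rewrite !mxE; ring.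
have first := h_first_order yh y.
have eE : yp - ytp = (1 - t) *: ((y - yt - q) + (q - (ytp - yt))) + (yp - y1).
  by rewrite /y1; apply/colP => i; rewrite !mxE; ring.
have := weighted_square3 (y - yt - q) (q - (ytp - yt)) (yp - y1) t t01'.
rewrite -eE.
set e := y - yt in yh_y yh_yt *; set d := ytp - yt.
set dl := yp - y1; set ep := yp - ytp => w3.
have yt_yh : yh - yt = (1 - t) *: e by rewrite -opprB yh_yt opprK.
clearbody e d dl ep.
move: co1 co2 first; rewrite yt_yh yh_yt yh_y gradE.
rewrite dotvNr !(@dotvZr) !(dotvDl (grad h yh)) !dotvNl !(@dotvZl).
move=> co1 co2 first.
have qe : dotv q q <= dotv q e.
  have c_gt0 : 0 < Lh * (1 - t) ^+ 2 by rewrite mulr_gt0 ?exprn_gt0.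
  rewrite -(ler_pM2l c_gt0); have := lerD co1 co2.
  lra_dot.
have t2_ge0 : 0 <= t ^+ 2 * ((1 - t) * Lh).
  by rewrite mulr_ge0 ?exprn_ge0 ?mulr_ge0 // ltW.
have := ler_wpM2l t2_ge0 qe.
have := ler_wpM2l (ltW Lh_gt0) w3.
have := ler_wpM2l (ltW t_gt0) co1.
have := ler_wpM2l (ltW u_gt0) first.
have : 0 <= Lh * t ^+ 3 * dotv e e.
  by rewrite mulr_ge0 ?dotvv_ge0 // mulr_ge0 ?exprn_ge0 // ltW.
rewrite !dotvE (dotvC e q) (dotvC d q); lra_dot.
Qed.

(** The squared distance between y and yt joins the potential to pay for the
    linearization of h at yt. *)
Lemma y_update_strong_h (bh : R) :
  bh = rho * opnorm B ^+ 2 + Lh / t ->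
  is_prox (1 / (t * bh)) g
    (yt - (1 / (t * bh)) *: (grad h yt + rho *: (B^T *m s))) ytp ->
  yp = y1 \/ is_prox (1 / bb) g (yh - (1 / bb) *: G) yp ->
  y_descent rho t xp y yh yp ys
    ((bh - muh / t) / 2 * dotv (yt - ys) (yt - ys)
     + Lh / 2 * dotv (y - yt) (y - yt))
    ((bh + mug / t) / 2 * dotv (ytp - ys) (ytp - ys)
     + Lh / 2 * dotv (yp - ytp) (yp - ytp)).
Proof.
rewrite /y_descent => bhE ytp_prox opt.
have ytp_dom := argmin_edom _ _ _ g_proper ytp_prox.
have tbh : t * bh = t * rho * opnorm B ^+ 2 + Lh.
  by rewrite bhE; field; rewrite gt_eqF.
have tbh_gt0 : 0 < t * bh.
  by rewrite tbh ltr_wpDl // mulr_ge0 ?exprn_ge0 ?opnorm_ge0 // mulr_ge0 // ltW.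
have := prox_three_point mug (t * bh) g yt _ ytp ys g_proper g_convex
  tbh_gt0 ytp_prox ys_dom.
move=> /(ler_wpM2l (ltW t_gt0)).
have := strong_first_order muh Lh h yt ys h_strong h_diff h_lip.
move=> /(ler_wpM2l (ltW t_gt0)).
have := y_update_options ytp_dom opt.
have := linearization_gap.
have -> : (1 - t) *: y + t *: ys - yh = t *: (ys - yt).
  by rewrite yhE; apply/colP => i; rewrite !mxE; ring.
have -> : dotv (yt - ys) (yt - ys) = dotv (ys - yt) (ys - yt).
  by rewrite -(opprB ys yt) dotvNl dotvNr opprK.
have -> : dotv (grad h yt + rho *: (B^T *m s)) (ytp - ys)
    = dotv (grad h yt) (ytp - yt) - dotv (grad h yt) (ys - yt)
      + rho * dotv s (B *m (ytp - yt)) - rho * dotv s (B *m (ys - yt)).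
  have -> : ytp - ys = (ytp - yt) - (ys - yt) by rewrite opprB subrKA.
  rewrite dotvDl dotvZl (dotvC (B^T *m _)) -dot_mulmx (dotvC (B *m _)).
  by rewrite mulmxBr !(dotvDr (ytp - yt), dotvDr (B *m _), dotvNr); ring.
rewrite (dotG (ytp - yt)) -scalemxAr !(dotvZr t) tbh.
have -> : t ^+ 2 * ((bh + mug / t) / 2 * dotv (ytp - ys) (ytp - ys)
                + Lh / 2 * dotv (yp - ytp) (yp - ytp))
   = t * (t * rho * opnorm B ^+ 2 + Lh + mug) / 2 * dotv (ytp - ys) (ytp - ys)
     + t ^+ 2 * (Lh / 2 * dotv (yp - ytp) (yp - ytp)).
  by rewrite -tbh; field; rewrite gt_eqF.
have -> : t ^+ 2 * ((bh - muh / t) / 2 * dotv (ys - yt) (ys - yt)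
                 + Lh / 2 * dotv (y - yt) (y - yt))
   = t * (t * rho * opnorm B ^+ 2 + Lh - muh) / 2 * dotv (ys - yt) (ys - yt)
     + t ^+ 2 * (Lh / 2 * dotv (y - yt) (y - yt)).
  by rewrite -tbh; field; rewrite gt_eqF.
have : 0 <= rho * opnorm B ^+ 2 / 2 * dotv (yp - y1) (yp - y1).
  by rewrite mulr_ge0 ?dotvv_ge0 // divr_ge0 // mulr_ge0 ?exprn_ge0 ?opnorm_ge0.
lra_dot.
Qed.

End y_update.

(** * Rates for the penalized gap *)

Section gap.
Variables (xs : 'cV[R]_p1) (ys : 'cV[R]_p2) (ls : 'cV[R]_n).
Local Notation F x y := (fine (f x) + fine (g y) + h y).
Hypothesis xs_dom : edom f xs.
Hypothesis ys_dom : edom g ys.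
Hypothesis zs_feasible : K (res xs ys).
Hypothesis ls_dual : forall x y r, edom f x -> edom g y -> K r ->
  F xs ys <= F x y - dotv (res x y - r) ls.

(** The multiplier is tested against the projection of the residual on K. *)
Lemma dual_lower_bound (x : 'cV[R]_p1) (y : 'cV[R]_p2) :
  edom f x -> edom g y ->
  - (enorm ls * dist_to K (res x y)) <= F x y - F xs ys.
Proof.
move=> x_dom y_dom.
have := ls_dual _ _ _ x_dom y_dom (projP (res x y)).1.
have := dotv_le_enorm (- off (res x y)) ls.
rewrite (dist_toE _ _ projP) enormN dotvNl -/(off _) mulrC; lra.
Qed.

(** Setting r = rho0 w d, the lower and upper bounds on the gap give
    (r - |ls|)^2 <= |ls|^2 + rho0 Rp2. *)
Lemma gap_dist_bound (x : 'cV[R]_p1) (y : 'cV[R]_p2) (w rho0 Rp2 : R)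
    (Rd := enorm ls + Num.sqrt (enorm ls ^+ 2 + rho0 * Rp2)) :
  0 < w -> 0 < rho0 -> 0 <= Rp2 -> edom f x -> edom g y ->
  F x y + w * rho0 * psi x y - F xs ys <= Rp2 / (2 * w) ->
  `|F x y - F xs ys|
    <= Num.max (rho0 * Rp2) (2 * enorm ls * Rd) / (2 * rho0 * w)
  /\ dist_to K (res x y) <= Rd / (rho0 * w).
Proof.
move=> w_gt0 rho0_gt0 Rp2_ge0 x_dom y_dom.
have rw_gt0 : 0 < rho0 * w by rewrite mulr_gt0.
have := dual_lower_bound _ _ x_dom y_dom.
have d_ge0 : 0 <= dist_to K (res x y) by rewrite (dist_toE _ _ projP) enorm_ge0.
rewrite psi_dist; move: (dist_to K (res x y)) d_ge0 => d d_ge0.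
move: (F x y) (F xs ys) => Fz Fs lo up.
have ls_ge0 := enorm_ge0 ls.
have d_le : d <= Rd / (rho0 * w).
  rewrite ler_pdivlMr // /Rd -lerBlDl.
  have [neg|pos] := leP (d * (rho0 * w) - enorm ls) 0.
    exact: le_trans neg (sqrtr_ge0 _).
  rewrite -(ger0_norm (ltW pos)) -sqrtr_sqr; apply: ler_wsqrtr.
  have : w * rho0 * (2^-1 * d ^+ 2) - enorm ls * d <= Rp2 / (2 * w) by lra.
  rewrite ler_pdivlMr ?mulr_gt0 // => /(ler_wpM2l (ltW rho0_gt0)).
  lra.
split=> //; have := ler_wpM2l ls_ge0 d_le => lsd_le.
have psi_ge0 : 0 <= w * rho0 * (2^-1 * d ^+ 2).
  by rewrite !mulr_ge0 ?exprn_ge0 ?invr_ge0 // ltW.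
have max1 : Rp2 / (2 * w) <=
    Num.max (rho0 * Rp2) (2 * enorm ls * Rd) / (2 * rho0 * w).
  have -> : Rp2 / (2 * w) = rho0 * Rp2 / (2 * rho0 * w).
    by field; rewrite !gt_eqF.
  by rewrite ler_pM2r ?le_max ?lexx // invr_gt0 -mulrA mulr_gt0.
have max2 : enorm ls * (Rd / (rho0 * w)) <=
    Num.max (rho0 * Rp2) (2 * enorm ls * Rd) / (2 * rho0 * w).
  have -> : enorm ls * (Rd / (rho0 * w)) = 2 * enorm ls * Rd / (2 * rho0 * w).
    by field; rewrite !gt_eqF.
  by rewrite ler_pM2r ?le_max ?lexx ?orbT // invr_gt0 -mulrA mulr_gt0.
rewrite ler_norml; apply/andP; split; lra.
Qed.

(** The part common to both schemes: [cc] are the weights w_k, and everything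
    about the y-update is in the hypotheses on [Psi] and [Psi']. *)
Lemma penalty_gap_rate (rho0 gamma0 : R) (tau cc rho gam Psi Psi' : nat -> R)
    (x xh : nat -> 'cV[R]_p1) (y yh : nat -> 'cV[R]_p2) :
  0 < rho0 -> 0 <= gamma0 -> (forall k, 0 <= gam k) ->
  tau 0%N = 1 -> (forall k, 0 < tau k <= 1) ->
  cc 0%N = 1 -> (forall k, 0 < cc k) ->
  (forall k, cc k.+1 * (1 - tau k.+1) = cc k) ->
  (forall k, rho k = cc k * rho0) ->
  (forall k, cc k * tau k ^+ 2 * gam k = gamma0) ->
  edom f (x 0%N) -> xh 0%N = x 0%N ->
  (forall k, argmin (fun u => f u + (rho k * psi u (yh k)
                            + gam k / 2 * enorm (u - xh k) ^+ 2)%:E)%E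
           (x k.+1)) ->
  (forall k, xh k.+1 =
     x k.+1 + (tau k.+1 * (1 - tau k) / tau k) *: (x k.+1 - x k)) ->
  (forall k, y_descent (rho k) (tau k) (x k.+1) (y k) (yh k) (y k.+1) ys
               (Psi k) (Psi' k)) ->
  (forall k,
     cc k.+1 * tau k.+1 ^+ 2 * Psi k.+1 <= cc k * tau k ^+ 2 * Psi' k) ->
  (forall k, 0 <= Psi' k) ->
  forall k, F (x k.+1) (y k.+1) + cc k * rho0 * psi (x k.+1) (y k.+1) - F xs ys
    <= (gamma0 / 2 * dotv (x 0%N - xs) (x 0%N - xs) + Psi 0%N) / cc k.
Proof.
move=> rho0_gt0 gamma0_ge0 gam_ge0 tau0 tau_itv cc0 cc_gt0 ccS rhoE gamE x0_dom
  xh0 x_min xhS y_desc PsiS Psi'_ge0 k.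
have tau_gt0 j : 0 < tau j by case/andP: (tau_itv j).
have rho_ge0 j : 0 <= rho j by rewrite rhoE mulr_ge0 // ltW.
have x_dom j : edom f (x j).
  by case: j => // j; exact: argmin_edom f_proper (x_min j).
have rhoS j : (1 - tau j.+1) * rho j.+1 = rho j.
  by rewrite !rhoE -(ccS j) mulrA (mulrC (1 - _)).
pose xt := anchor tau x.
pose E j := F (x j) (y j) + (1 - tau j) * rho j * psi (x j) (y j) - F xs ys.
pose D j := gamma0 / 2 * dotv (xt j - xs) (xt j - xs).
pose S j := D j + cc j * tau j ^+ 2 * Psi j.
pose S' j := D j.+1 + cc j * tau j ^+ 2 * Psi' j.
have step j : cc j * E j.+1 + S' j <= cc j * ((1 - tau j) * E j) + S j.
  have t01 : 0 <= tau j <= 1 by case/andP: (tau_itv j) => /ltW -> ->.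
  have := x_update_descent (rho j) (gam j) (xh j) (x j.+1) (yh j) (rho_ge0 j)
    (x_min j) (tau j) (x j) (xt j) (xt j.+1) xs (y j) ys t01 (gam_ge0 j)
    (x_dom j) xs_dom zs_feasible
    (extrapolation_anchor tau x xh tau_gt0 j xh0 xhS)
    (anchorS tau x tau_gt0 j).
  have := y_desc j; rewrite /y_descent => yd xd.
  have := ler_wpM2l (ltW (cc_gt0 j)) (lerD yd xd); clear yd xd.
  rewrite /S /S' /D /E rhoS.
  move: (dotv (xt j - xs) _) (dotv (xt j.+1 - xs) _) => d0 d1.
  rewrite -(gamE j); lra_dot.
have SS' j : S j.+1 <= S' j by rewrite /S /S' lerD2l.
have := lyapunov_decrease E cc tau S S' tau0 ccS step SS' k.
rewrite /S cc0 tau0 expr1n !mul1r -/(D 0%N) => bound.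
rewrite ler_pdivlMr // mulrC.
have S'_ge0 : 0 <= S' k.
  by rewrite addr_ge0 ?mulr_ge0 ?dotvv_ge0 ?divr_ge0 ?exprn_ge0 // ltW.
move: bound; rewrite /E rhoS rhoE /D /xt /=; lra.
Qed.

(** With tau_k = 1 / (k + 1) the extrapolation coefficient k / (k + 2) is
    tau_{k+1} (1 - tau_k) / tau_k, and the weight tau_k bb_k =
    rho0 |B|^2 + Lh / (k + 1) of the y-distances is nonincreasing. *)
Lemma algorithm1_gap_rate (rho0 gamma0 : R) (rho gamma bh : nat -> R)
    (x xh : nat -> 'cV[R]_p1) (y yh : nat -> 'cV[R]_p2) (k : nat) :
  (forall k, bh k = rho k * opnorm B ^+ 2 + Lh) ->
  algorithm1 f g h A B c K rho0 gamma0 rho gamma bh x xh y yh ->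
  edom f (x k) /\ edom g (y k) /\ 
  (F (x k.+1) (y k.+1) + k.+1%:R * rho0 * psi (x k.+1) (y k.+1) - F xs ys
    <= Rp2 B Lh rho0 gamma0 (x 0%N) xs (y 0%N) ys / (2 * k.+1%:R)).
Proof.
move=> bhE [x0_dom y0_dom rho0_gt0 gamma0_ge0 rho_0 gamma_0 xh0 yh0 x_min y_prox
  xhS yhS rhoS gammaS].
have rhoE j : rho j = j.+1%:R * rho0 by case: j => [|j]; rewrite ?rho_0 ?mul1r.
have gammaE j : gamma j = j.+1%:R * gamma0.
  by case: j => [|j]; rewrite ?gamma_0 ?mul1r // gammaS mulrC.
have x_dom j : edom f (x j).
  by case: j => // j; exact: argmin_edom f_proper (x_min j).
have y_dom j : edom g (y j).
  by case: j => // j; exact: argmin_edom g_proper (y_prox j).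
do 2!split => //.
pose tau j : R := j.+1%:R^-1.
have tau_gt0 j : 0 < tau j by rewrite invr_gt0 ltr0n.
have tau_itv j : 0 < tau j <= 1 by rewrite tau_gt0 invf_le1 ?ltr0n // ler1n.
have tau_mul j : j.+1%:R * tau j = 1 by rewrite divff // pnatr_eq0.
have weightE j : tau j.+1 * (1 - tau j) / tau j = j%:R / j.+2%:R.
  rewrite /tau invrK -mulrA mulrBl mul1r mulVf ?pnatr_eq0 //.
  by rewrite -(natr1 j) addrK mulrC.
have rho_ge0 j : 0 <= rho j by rewrite rhoE mulr_ge0 // ltW.
pose bb j := rho j * opnorm B ^+ 2 + Lh.
pose yt := anchor tau y.
pose Psi j := bb j / 2 * dotv (yt j - ys) (yt j - ys).
pose Psi' j := bb j / 2 * dotv (yt j.+1 - ys) (yt j.+1 - ys).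
have yhS' j : yh j.+1 =
    y j.+1 + (tau j.+1 * (1 - tau j) / tau j) *: (y j.+1 - y j).
  by rewrite weightE.
have xhS' j : xh j.+1 =
    x j.+1 + (tau j.+1 * (1 - tau j) / tau j) *: (x j.+1 - x j).
  by rewrite weightE.
have bb_ge0 j : 0 <= bb j.
  by rewrite addr_ge0 ?mulr_ge0 ?exprn_ge0 ?opnorm_ge0 // ltW.
have tau0 : tau 0%N = 1 by rewrite /tau invr1.
have y_desc j : y_descent (rho j) (tau j) (x j.+1) (y j) (yh j) (y j.+1) ys
    (Psi j) (Psi' j).
  apply: y_update_prox => //.
  - exact: extrapolation_anchor.
  - by have := y_prox j; rewrite bhE (grad_y_psiE _ _ _ _ _ projP).
  - exact: anchorS.
have ccS j : j.+2%:R * (1 - tau j.+1) = j.+1%:R :> R.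
  by rewrite mulrBr mulr1 tau_mul -(natr1 j.+1) addrK.
have tau2 j : j.+1%:R * tau j ^+ 2 = tau j by rewrite expr2 mulrA tau_mul mul1r.
apply: le_trans (penalty_gap_rate rho0 gamma0 tau (fun j => j.+1%:R) rho gamma
  Psi Psi' x xh y yh rho0_gt0 gamma0_ge0 _ tau0 tau_itv _ _ ccS rhoE _ x0_dom
  xh0 x_min xhS' y_desc _ _ k) _.
- by move=> j; rewrite gammaE mulr_ge0.
- by [].
- by move=> j; rewrite ltr0n.
- by move=> j; rewrite tau2 gammaE mulrA [tau j * _]mulrC tau_mul mul1r.
- move=> j; rewrite !tau2 /Psi /Psi' !mulrA.
  apply: ler_wpM2r; first exact: dotvv_ge0.
  apply: ler_wpM2r; first by rewrite invr_ge0.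
  rewrite /bb !rhoE !mulrDr !mulrA ![tau _ * _]mulrC !tau_mul !mul1r lerD2l.
  by rewrite ler_wpM2l ?(ltW Lh_gt0) // lef_pV2 ?posrE ?ltr0n // ler_nat.
- by move=> j; rewrite mulr_ge0 ?dotvv_ge0 // divr_ge0.
rewrite invfM mulrA; apply: ler_wpM2r; first by rewrite invr_ge0 ler0n.
rewrite /Psi /bb rhoE mul1r /yt /= /Rp2 !enorm_sq; lra_dot.
Qed.

(** Since rho_k tau_k ^ 2 = rho0, the increment rho_{k+1} - rho_k equals
    rho0 / tau_{k+1}: it is of the same order as the gain mu / tau_k offered by
    strong convexity, and tau_{k+1} >= tau_k / 2 leads to the bound on rho0. *)
Lemma algorithm2_gap_rate (rho0 gamma0 : R) (tau rho bh : nat -> R)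
    (x xh : nat -> 'cV[R]_p1) (y yh yt yb : nat -> 'cV[R]_p2) (k : nat) :
  algorithm2 f g h A B c K Lh rho0 gamma0 tau rho bh x xh y yh yt yb ->
  ([/\ 0 < mug,
         (forall k, yb k = yh k),
         0 < rho0 <= mug / (2 * opnorm B ^+ 2) &
         forall k, bh k = rho k * opnorm B ^+ 2 + Lh]
     \/
     [/\ Lh < 2 * muh,
         (forall k, yb k = yt k),
         0 < rho0 <= (mug + 2 * muh - Lh) / (2 * opnorm B ^+ 2) &
         forall k, bh k = rho k * opnorm B ^+ 2 + Lh / tau k]) ->
  [/\ 0 < tau k, k.+2%:R * tau k <= 2, edom f (x k), edom g (y k) &
    F (x k.+1) (y k.+1) + (tau k ^- 2) * rho0 * psi (x k.+1) (y k.+1) - F xs ys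
    <= Rp2 B Lh rho0 gamma0 (x 0%N) xs (y 0%N) ys / (2 * tau k ^- 2)].
Proof.
move=> [x0_dom y0_dom rho0_gt0 gamma0_ge0 rho_0 tau0 xh0 yt0 tauS yhE x_min
  xhS yt_prox y_opt rhoS] choices.
have itv := tau_itv tau tau0 tauS.
have gt0 := tau_gt0 tau tau0 tauS.
have half := tau_half tau tau0 tauS.
have sqS := tau_sqS tau tau0 tauS.
have sq_gt0 j : 0 < tau j ^+ 2 by rewrite exprn_gt0.
have lt1 j : 0 < 1 - tau j.+1 by rewrite -(pmulr_lgt0 _ (sq_gt0 j)) -sqS.
pose cc j := tau j ^- 2.
have cc_sq j : cc j * tau j ^+ 2 = 1 by rewrite mulVf // gt_eqF.
have cc_gt0 j : 0 < cc j by rewrite invr_gt0.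
have ccS j : cc j.+1 * (1 - tau j.+1) = cc j.
  by rewrite /cc sqS invfM mulrAC mulVf ?mul1r // gt_eqF.
have rhoE j : rho j = cc j * rho0.
  elim: j => [|j IH]; first by rewrite rho_0 /cc tau0 expr1n invr1 mul1r.
  by rewrite rhoS IH -(ccS j) mulrAC mulfK // gt_eqF.
have rho_sq j : rho j * tau j ^+ 2 = rho0 by rewrite rhoE mulrAC cc_sq mul1r.
have rho_ge0 j : 0 <= rho j by rewrite rhoE mulr_ge0 // ltW.
have rho_diff j : rho j.+1 - rho j = rho0 / tau j.+1.
  have -> : rho j = rho j.+1 * (1 - tau j.+1) by rewrite rhoS divfK // gt_eqF.
  by rewrite -(rho_sq j.+1); field; rewrite gt_eqF.
have x_dom j : edom f (x j).
  by case: j => // j; exact: argmin_edom f_proper (x_min j).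
have yt_dom j : edom g (yt j.+1) by exact: argmin_edom g_proper (yt_prox j).
have y_dom j : edom g (y j).
  elim: j => // j IH; have [->|] := y_opt j; last exact: argmin_edom g_proper.
  have t01 : 0 <= tau j <= 1 by case/andP: (itv j) => /ltW -> ->.
  by have [] := g_convex_le (y j) (yt j.+1) (tau j) t01 IH (yt_dom j).
have b_ge0 : 0 <= opnorm B ^+ 2 by rewrite exprn_ge0 // opnorm_ge0.
have b_bound r : 0 < rho0 <= r / (2 * opnorm B ^+ 2) ->
    rho0 * opnorm B ^+ 2 <= r / 2.
  have [->|b_neq0] := eqVneq (opnorm B ^+ 2) 0.
    by rewrite mulr0 invr0 mulr0 => /andP[/lt_le_trans lt /lt]; rewrite ltxx.
  have b_gt0 : 0 < opnorm B ^+ 2 by rewrite lt_def b_neq0.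
  have b2_gt0 : 0 < 2 * opnorm B ^+ 2 by rewrite mulr_gt0.
  by move=> /andP[_]; rewrite ler_pdivlMr //; lra.
have opt j : y j.+1 = (1 - tau j) *: y j + tau j *: yt j.+1 \/
    is_prox (1 / (rho j * opnorm B ^+ 2 + Lh)) g
      (yh j - (1 / (rho j * opnorm B ^+ 2 + Lh)) *:
        (grad h (yh j) + rho j *: (B^T *m off (res (x j.+1) (yh j))))) (y j.+1).
  by have := y_opt j; rewrite (grad_y_psiE _ _ _ _ _ projP).
split=> //; first exact: tau_le.
suff [Psi [Psi' [y_desc PsiS Psi'_ge0 Psi0]]] : exists Psi Psi' : nat -> R,
   [/\ forall j, y_descent (rho j) (tau j) (x j.+1) (y j) (yh j) (y j.+1) ys
                   (Psi j) (Psi' j),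
       forall j, Psi j.+1 <= Psi' j, forall j, 0 <= Psi' j &
       Psi 0%N <= (Lh + rho0 * opnorm B ^+ 2) / 2
                  * dotv (y 0%N - ys) (y 0%N - ys)].
  apply: le_trans (penalty_gap_rate rho0 gamma0 tau cc rho (fun=> gamma0) Psi
    Psi' x xh y yh rho0_gt0 gamma0_ge0 _ tau0 itv _ cc_gt0 ccS rhoE _ x0_dom
    xh0 x_min xhS y_desc _ Psi'_ge0 k) _.
  - by [].
  - by rewrite /cc tau0 expr1n invr1.
  - by move=> j; rewrite cc_sq mul1r.
  - by move=> j; rewrite !cc_sq !mul1r.
  rewrite [leRHS](_ : _ = Rp2 B Lh rho0 gamma0 (x 0%N) xs (y 0%N) ys / 2 / cc k);
    last by rewrite invfM mulrA.
  apply: ler_wpM2r; first by rewrite invr_ge0 ltW.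
  move: Psi0; rewrite /Rp2 !enorm_sq; lra_dot.
pose D j := dotv (yt j - ys) (yt j - ys).
case: choices => [[_ ybE rho0_le bhE]|[Lh_lt ybE rho0_le bhE]].
- exists (fun j => bh j / 2 * D j),
    (fun j => (bh j + mug / tau j) / 2 * D j.+1).
  have bh_ge0 j : 0 <= bh j.
    by rewrite bhE; apply: addr_ge0; [exact: mulr_ge0 | exact: ltW].
  have mut_ge0 j : 0 <= mug / tau j by rewrite divr_ge0 // ltW.
  split=> [j|j|j|].
  + have := yt_prox j; rewrite (grad_y_psiE _ _ _ _ _ projP) ybE => prox.
    exact: (y_update_strong_g _ _ _ _ _ _ _ _ _ (rho_ge0 j) (itv j) (y_dom j)
      ys_dom (yhE j) _ (bhE j) prox (opt j)).
  + apply: ler_wpM2r; first exact: dotvv_ge0.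
    apply: ler_wpM2r; first by rewrite invr_ge0.
    suff : (rho j.+1 - rho j) * opnorm B ^+ 2 <= mug / tau j.
      by rewrite !bhE; lra.
    rewrite rho_diff mulrAC ler_pdivrMr // mulrAC ler_pdivlMr //.
    have := ler_wpM2r (ltW (gt0 j)) (b_bound _ rho0_le).
    have := ler_wpM2l mug_ge0 (half j); lra.
  + by rewrite mulr_ge0 ?dotvv_ge0 // divr_ge0 // addr_ge0.
  + by rewrite /D yt0 bhE rho_0 [_ + Lh]addrC.
- exists (fun j => (bh j - muh / tau j) / 2 * D j
       + Lh / 2 * dotv (y j - yt j) (y j - yt j)),
    (fun j => (bh j + mug / tau j) / 2 * D j.+1
       + Lh / 2 * dotv (y j.+1 - yt j.+1) (y j.+1 - yt j.+1)).
  have bh_ge0 j : 0 <= bh j.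
    rewrite bhE; apply: addr_ge0; first exact: mulr_ge0.
    by rewrite ltW // divr_gt0.
  have mut_ge0 j : 0 <= mug / tau j by rewrite divr_ge0 // ltW.
  split=> [j|j|j|].
  + have := yt_prox j; rewrite (grad_y_psiE _ _ _ _ _ projP) ybE => prox.
    exact: (y_update_strong_h _ _ _ _ _ _ _ _ _ (rho_ge0 j) (itv j) (y_dom j)
      ys_dom (yhE j) _ (bhE j) prox (opt j)).
  + rewrite lerD2r; apply: ler_wpM2r; first exact: dotvv_ge0.
    apply: ler_wpM2r; first by rewrite invr_ge0.
    suff : (rho j.+1 - rho j) * opnorm B ^+ 2 + (Lh - muh) / tau j.+1
        <= (Lh + mug) / tau j by rewrite !bhE; lra.
    rewrite rho_diff mulrAC -mulrDl ler_pdivrMr // mulrAC ler_pdivlMr //.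
    have := ler_wpM2r (ltW (gt0 j)) (b_bound _ rho0_le).
    have := ler_wpM2l (addr_ge0 (ltW Lh_gt0) mug_ge0) (half j); lra.
  + rewrite addr_ge0 // mulr_ge0 ?dotvv_ge0 // divr_ge0 // ?addr_ge0 //.
    exact: ltW.
  + rewrite /D yt0 bhE rho_0 tau0 !divr1 subrr dotv0l mulr0 addr0.
    apply: ler_wpM2r; first exact: dotvv_ge0.
    apply: ler_wpM2r; first by rewrite invr_ge0.
    rewrite [Lh + _]addrC gerBl ltW // -(pmulr_rgt0 _ (ltr0n R 2)).
    exact: lt_trans Lh_lt.
Qed.

End gap.

End step.

(** * Saddle points and the optimal value *)

Section saddle.
Context {R : realType} {n p1 p2 : nat}.
Variables (f : 'cV[R]_p1 -> \bar R) (g : 'cV[R]_p2 -> \bar R).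
Variables (h : 'cV[R]_p2 -> R).
Variables (A : 'M[R]_(n, p1)) (B : 'M[R]_(n, p2)) (c : 'cV[R]_n).
Variable K : set 'cV[R]_n.
Hypothesis f_proper : proper_function f.
Hypothesis g_proper : proper_function g.

Local Notation F x y := (fine (f x) + fine (g y) + h y).

Lemma obj_fine x y : edom f x -> edom g y -> obj f g h x y = (F x y)%:E.
Proof.
move=> x_dom y_dom.
rewrite /obj (edom_fineK _ _ f_proper.1 x_dom).
by rewrite (edom_fineK _ _ g_proper.1 y_dom).
Qed.

Lemma obj_outside x y : ~ (edom f x /\ edom g y) -> obj f g h x y = +oo%E.
Proof.
rewrite /obj /edom /= => out.
have := g_proper.1 y; have := f_proper.1 x; move: out.
case: (f x) => [a| |]; case: (g y) => [b| |] //=.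
by move=> out; exfalso; apply: out; rewrite !ltry.
Qed.

(** The dual inequality tested at ls - v, where v is the violation, reads
    |v|^2 <= 0. *)
Lemma saddle_feasible xs ys rs ls :
  saddle_point f g h A B c K xs ys rs ls -> resid A B c xs ys = rs.
Proof.
move=> [xs_dom ys_dom _ dual_max _].
pose v := A *m xs + B *m ys - rs - c.
have := dual_max (ls - v); rewrite /lagrangian obj_fine // -!EFinB lee_fin -/v.
rewrite (dotvDr ls) dotvNr => le_v.
have v0 : v = 0.
  by apply/dotvv_eq0/le_anti; rewrite dotvv_ge0 andbT; lra.
by apply/eqP; rewrite -subr_eq0 -[0 in X in _ == X]v0 /v /resid addrAC.
Qed.

Lemma saddle_value xs ys rs ls x y r :
  saddle_point f g h A B c K xs ys rs ls ->
  edom f x -> edom g y -> K r ->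
  F xs ys <= F x y - dotv (resid A B c x y - r) ls.
Proof.
move=> sp x_dom y_dom Kr; have feas := saddle_feasible _ _ _ _ sp.
have [xs_dom ys_dom _ _ primal_min] := sp.
have residE u v w : A *m u + B *m v - w - c = resid A B c u v - w.
  by rewrite /resid addrAC.
have := primal_min x y r x_dom y_dom Kr.
rewrite /lagrangian !obj_fine // -!EFinB lee_fin !residE feas subrr.
by rewrite dotv0l subr0.
Qed.

(** The primal and dual components may come from two different saddle points:
    both primal points are feasible and optimal, so the two saddle values agree
    and the multiplier of one serves the other. *)
Lemma saddle_optimality xs ys ls :
  Zstar f g h A B c K (xs, ys) -> Lstar f g h A B c K ls ->
  [/\ edom f xs, edom g ys, K (resid A B c xs ys),
      Fstar f g h A B c K = (F xs ys)%:E &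
      forall x y r, edom f x -> edom g y -> K r ->
        F xs ys <= F x y - dotv (resid A B c x y - r) ls].
Proof.
move=> [rs [l1 /= sp1]] [x2 [y2 [r2 sp2]]].
have [xs_dom ys_dom Krs _ _] := sp1; have [x2_dom y2_dom Kr2 _ _] := sp2.
have feas1 := saddle_feasible _ _ _ _ sp1.
have feas2 := saddle_feasible _ _ _ _ sp2.
have value x y : edom f x -> edom g y -> K (resid A B c x y) ->
    F xs ys <= F x y.
  move=> x_dom y_dom Kxy.
  have := saddle_value _ _ _ _ _ _ _ sp1 x_dom y_dom Kxy.
  by rewrite subrr dotv0l subr0.
split; rewrite ?feas1 //.
  apply/le_anti/andP; split.
    apply: ereal_inf_lbound; exists (xs, ys) => /=; first by rewrite feas1.
    by rewrite obj_fine.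
  apply/ereal_infP => _ [[x y] /= Kxy <-].
  have [[x_dom y_dom]|out] := pselect (edom f x /\ edom g y).
    by rewrite obj_fine // lee_fin value.
  by rewrite obj_outside // leey.
move=> x y r x_dom y_dom Kr.
apply: le_trans (saddle_value _ _ _ _ _ _ _ sp2 x_dom y_dom Kr).
by apply: value; rewrite ?feas2.
Qed.

End saddle.

(** * The convergence rates *)

Theorem theorem3 (R : realType) (n p1 p2 : nat)
  (f : 'cV[R]_p1 -> \bar R) (g : 'cV[R]_p2 -> \bar R) (h : 'cV[R]_p2 -> R)
  (A : 'M[R]_(n, p1)) (B : 'M[R]_(n, p2)) (c : 'cV[R]_n) (K : set 'cV[R]_n)
  (Lh : R) (xs : 'cV[R]_p1) (ys : 'cV[R]_p2) (ls : 'cV[R]_n)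
  (f_proper : proper_function f) (f_closed : closed_function f) (f_convex : econvex f)
  (g_proper : proper_function g) (g_closed : closed_function g) (g_convex : econvex g)
  (B_neq0 : B != 0)
  (K_neq0 : K !=set0) (K_closed : closed K)
  (K_convex : convex_set (K : set (convex_lmodType 'cV[R]_n)))
  (h_convex : econvex (EFin \o h))
  (h_diff : forall y, differentiable h y)
  (Lh_gt0 : 0 < Lh)
  (h_lip : forall y y', enorm (grad h y - grad h y') <= Lh * enorm (y - y'))
  (saddle_ex : exists x y r l, saddle_point f g h A B c K x y r l)
  (Fstar_fin : Fstar f g h A B c K \is a fin_num)
  (Fstar_attained : exists z, [/\ Zstar f g h A B c K z,
     K (resid A B c z.1 z.2) & obj f g h z.1 z.2 = Fstar f g h A B c K])
  (zs_opt : Zstar f g h A B c K (xs, ys))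
  (ls_opt : Lstar f g h A B c K ls) :
  (forall (rho0 gamma0 : R) (rho gamma bh : nat -> R)
      (x xh : nat -> 'cV[R]_p1) (y yh : nat -> 'cV[R]_p2),
    (forall k, bh k = rho k * opnorm B ^+ 2 + Lh) ->
    algorithm1 f g h A B c K rho0 gamma0 rho gamma bh x xh y yh ->
    let Rp2 := Rp2 B Lh rho0 gamma0 (x 0%N) xs (y 0%N) ys in
    let Rd := Rd B Lh rho0 gamma0 (x 0%N) xs (y 0%N) ys ls in
    forall k : nat, (1 <= k)%N ->
      (`| obj f g h (x k) (y k) - Fstar f g h A B c K |
         <= (Num.max (rho0 * Rp2) (2 * enorm ls * Rd)
               / (2 * rho0 * k%:R))%:E)%E
      /\ dist_to K (resid A B c (x k) (y k)) <= Rd / (rho0 * k%:R))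
  /\
  (forall (mug muh : R) (rho0 gamma0 : R) (tau rho bh : nat -> R)
      (x xh : nat -> 'cV[R]_p1) (y yh yt yb : nat -> 'cV[R]_p2),
    0 <= mug -> 0 <= muh ->
    strongly_convex mug g -> strongly_convex muh (EFin \o h) ->
    0 < mug + muh ->
    algorithm2 f g h A B c K Lh rho0 gamma0 tau rho bh x xh y yh yt yb ->
    ([/\ 0 < mug,
         (forall k, yb k = yh k),
         0 < rho0 <= mug / (2 * opnorm B ^+ 2) &
         forall k, bh k = rho k * opnorm B ^+ 2 + Lh]
     \/
     [/\ Lh < 2 * muh,
         (forall k, yb k = yt k),
         0 < rho0 <= (mug + 2 * muh - Lh) / (2 * opnorm B ^+ 2) &
         forall k, bh k = rho k * opnorm B ^+ 2 + Lh / tau k]) ->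
    let Rp2 := Rp2 B Lh rho0 gamma0 (x 0%N) xs (y 0%N) ys in
    let Rd := Rd B Lh rho0 gamma0 (x 0%N) xs (y 0%N) ys ls in
    forall k : nat, (1 <= k)%N ->
      (`| obj f g h (x k) (y k) - Fstar f g h A B c K |
         <= (2 * Num.max (rho0 * Rp2) (2 * enorm ls * Rd)
               / (rho0 * k.+1%:R ^+ 2))%:E)%E
      /\ dist_to K (resid A B c (x k) (y k)) <= 4 * Rd / (rho0 * k.+1%:R ^+ 2)).
Proof.
have [P projP] := projection_exists K K_neq0 K_closed K_convex.
have [xs_dom ys_dom zs_feas FstarE ls_dual] :=
  saddle_optimality f g h A B c K f_proper g_proper xs ys ls zs_opt ls_opt.
have Rp2_ge0 rho0 gamma0 x0 y0 : 0 < rho0 -> 0 <= gamma0 ->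
    0 <= Rp2 B Lh rho0 gamma0 x0 xs y0 ys.
  move=> rho0_gt0 gamma0_ge0.
  by rewrite addr_ge0 // mulr_ge0 ?exprn_ge0 ?enorm_ge0 // addr_ge0 ?mulr_ge0
     ?exprn_ge0 ?opnorm_ge0 // ltW.
have Rd_ge0 rho0 gamma0 x0 y0 : 0 <= Rd B Lh rho0 gamma0 x0 xs y0 ys ls.
  by rewrite addr_ge0 ?enorm_ge0 ?sqrtr_ge0.
split.
- move=> rho0 gamma0 rho gamma bh x xh y yh bhE alg Rp Rdd [//|k] _.
  have rate j := algorithm1_gap_rate f g h A B c K P Lh 0 f_proper f_convex
    g_proper (strongly_convex0 _ g_convex) (lexx 0) h_convex h_diff Lh_gt0 h_lip
    projP xs ys xs_dom ys_dom zs_feas rho0 gamma0 rho gamma bh x xh y yh j bhE alg.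
  have [x_dom [y_dom _]] := rate k.+1; have [_ [_ gap]] := rate k.
  rewrite obj_fine // FstarE -EFinB abse_EFin lee_fin.
  have rho0_gt0 : 0 < rho0 by case: alg.
  have gamma0_ge0 : 0 <= gamma0 by case: alg.
  exact: (gap_dist_bound f g h A B c K P projP xs ys ls ls_dual _ _ _ _ _
    (ltr0Sn R k) rho0_gt0 (Rp2_ge0 _ _ _ _ rho0_gt0 gamma0_ge0) x_dom y_dom
    gap).
- move=> mug muh rho0 gamma0 tau rho bh x xh y yh yt yb mug_ge0 muh_ge0 g_strong
    h_strong _ alg choices Rp Rdd [//|k] _.
  have rate j := algorithm2_gap_rate f g h A B c K P Lh muh mug f_proper f_convex
    g_proper g_strong mug_ge0 h_convex h_strong h_diff Lh_gt0 h_lip projP xs ys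
    xs_dom ys_dom zs_feas rho0 gamma0 tau rho bh x xh y yh yt yb j alg choices.
  have [_ _ x_dom y_dom _] := rate k.+1.
  have [tau_gt0 tau_le _ _ gap] := rate k.
  have rho0_gt0 : 0 < rho0 by case: alg.
  have gamma0_ge0 : 0 <= gamma0 by case: alg.
  have w_gt0 : 0 < tau k ^- 2 by rewrite invr_gt0 exprn_gt0.
  have w_inv : (tau k ^- 2)^-1 <= 4 / k.+2%:R ^+ 2.
    rewrite invrK ler_pdivlMr ?exprn_gt0 ?ltr0n // mulrC -exprMn.
    have -> : 4 = 2 ^+ 2 :> R by ring.
    by rewrite ler_sqr ?nnegrE ?mulr_ge0 ?ler0n // ltW.
  have [gap_le dist_le] := gap_dist_bound f g h A B c K P projP xs ys ls ls_dual
    _ _ _ _ _ w_gt0 rho0_gt0 (Rp2_ge0 _ _ _ _ rho0_gt0 gamma0_ge0) x_dom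
    y_dom gap.
  have scale a N : 0 < a -> 0 <= N ->
      N / (a * tau k ^- 2) <= 4 * N / (a * k.+2%:R ^+ 2).
    move=> a_gt0 N_ge0.
    rewrite !(invfM a) [4 * N]mulrC mulrACA [N * (_ * _)]mulrA.
    by apply: ler_wpM2l => //; rewrite divr_ge0 // ltW.
  rewrite obj_fine // FstarE -EFinB abse_EFin lee_fin; split.
    apply: le_trans gap_le _; apply: le_trans (scale _ _ _ _) _.
    + by rewrite mulr_gt0.
    + by rewrite le_max mulr_ge0 ?Rp2_ge0 // ltW.
    + rewrite le_eqVlt; apply/orP; left; apply/eqP.
      move: (Num.max _ _) (k.+2%:R ^+ 2) => N q.
      rewrite -[2 * rho0 * q]mulrA invfM mulrACA -[RHS]mulrA; congr (_ * _).
      by field.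
  exact: le_trans dist_le (scale _ _ rho0_gt0 (Rd_ge0 _ _ _ _)).
Qed.
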